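(* Let $X$ be a hereditarily semi-Kelley dendroid. Then $X$ is smooth.
   Context: A continuum is a compact connected metric space with more than one point. A subcontinuum of a continuum $X$ is a non-empty compact connected subset of $X$ (one-point sets are allowed). Convergence of subcontinua is with respect to the Hausdorff metric. An arc is a space homeomorphic to $[0,1]$. A dendroid is an arc-wise connected continuum $X$ such that the intersection of any two subcontinua of $X$ is connected. For a dendroid $X$ and $a,b\in X$, $ab$ denotes the (unique) arc in $X$ with end points $a$ and $b$ (with $ab=\{a\}$ if $a=b$). A dendroid $X$ is smooth if there exists a point $p\in X$ such that for each sequence $\{x_n\}_{n=1}^\infty$ in $X$ converging to some $x\in X$, $\lim px_n=px$. Let $K$ be a subcontinuum of a continuum $Z$. A maximal limit continuum of $K$ is a subcontinuum $M\subset K$ for which there is a sequence $\{M_n\}_{n=1}^\infty$ of subcontinua of $Z$ converging to $M$ such that for each convergent sequence $\{M_n'\}_{n=1}^\infty$ of subcontinua of $Z$ with $M_n\subset M_n'$ for each $n\in\mathbb N$ and $\lim M_n'=M'\subset K$, we have $M'=M$. A continuum $Z$ is semi-Kelley if for each subcontinuum $K$ of $Z$ and every two maximal limit continua $L$ and $M$ of $K$, either $L\subset M$ or $M\subset L$. A continuum is hereditarily semi-Kelley if each of its subcontinua is semi-Kelley (one-point subcontinua are trivially semi-Kelley). *)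

(* Defs.v *)
From HB Require Import structures.
From mathcomp Require Import all_boot all_order all_algebra.
From mathcomp Require Import all_classical all_reals all_analysis.

Set Implicit Arguments.
Unset Strict Implicit.
Unset Printing Implicit Defensive.

Import Order.TTheory GRing.Theory Num.Theory.
Import numFieldNormedType.Exports.

Local Open Scope classical_set_scope.
Local Open Scope ring_scope.

(* Continua, dendroids, etc. are represented as subsets of an ambient metric   *)
(* space T; a metric space in its own right is the case [set: T].  Compactness *)
(* and connectedness of a subset do not depend on the ambient space.           *)

Definition homeomorphism (U V : topologicalType) (A : set U) (B : set V)
    (f : U -> V) : Prop :=
  [/\ set_bij A B f, {within A, continuous f} &
      exists2 g : V -> U, {in A, cancel f g} & {within B, continuous g}].

Section Continua.
Context {R : realType} {T : metricType R}.
Implicit Types (A B K L M X Z : set T) (a b p x : T).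

Definition continuum X : Prop :=
  [/\ compact X, connected X & exists x y : T, [/\ X x, X y & x <> y]].

Definition subcontinuum X A : Prop :=
  [/\ A `<=` X, A !=set0, compact A & connected A].

Definition set_neighborhood (e : R) A : set T := \bigcup_(a in A) ball a e.

(* The infimum is the Hausdorff distance when A and B are nonempty and         *)
(* bounded; [inf] is 0 on sets without infimum, so other arguments give junk.  *)
Definition hausdorff_dist A B : R :=
  inf [set e : R | [/\ 0 < e, A `<=` set_neighborhood e B &
                       B `<=` set_neighborhood e A]].

(* A limit is unique among closed sets only; below, limits are compact.        *)
Definition hausdorff_cvg (A_ : nat -> set T) A : Prop :=
  hausdorff_dist (A_ n) A @[n --> \oo] --> (0 : R).

Definition arc_with_endpoints a b A : Prop :=
  exists f : R -> T,
    [/\ homeomorphism (`[0, 1] : set R) A f, f 0 = a & f 1 = b].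

Definition arcwise_connected X : Prop :=
  forall a b, X a -> X b -> a <> b ->
    exists2 A, A `<=` X & arc_with_endpoints a b A.

Definition dendroid X : Prop :=
  [/\ continuum X, arcwise_connected X &
      forall A B, subcontinuum X A -> subcontinuum X B -> connected (A `&` B)].

(* In a dendroid X the set of arcs from a to b is a singleton when a <> b, so  *)
(* the choice made by [xget] is forced and its default set0 is never used.     *)
Definition arc_of X a b : set T :=
  if a == b then [set a]
  else xget set0 [set A | A `<=` X /\ arc_with_endpoints a b A].

Definition smooth X : Prop :=
  exists2 p, X p &
    forall (x_ : nat -> T) x, (forall n, X (x_ n)) -> X x ->
      x_ n @[n --> \oo] --> x ->
      hausdorff_cvg (fun n => arc_of X p (x_ n)) (arc_of X p x).

Definition maximal_limit_continuum Z K M : Prop :=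
  subcontinuum K M /\
  exists M_ : nat -> set T,
    [/\ forall n, subcontinuum Z (M_ n), hausdorff_cvg M_ M &
        forall (M'_ : nat -> set T) (M' : set T),
          (forall n, subcontinuum Z (M'_ n)) -> (forall n, M_ n `<=` M'_ n) ->
          subcontinuum Z M' -> hausdorff_cvg M'_ M' -> M' `<=` K -> M' = M].

Definition semi_kelley Z : Prop :=
  forall K, subcontinuum Z K ->
  forall L M, maximal_limit_continuum Z K L -> maximal_limit_continuum Z K M ->
    L `<=` M \/ M `<=` L.

(* One-point subcontinua satisfy [semi_kelley] trivially.                      *)
Definition hereditarily_semi_kelley X : Prop :=
  forall Z, subcontinuum X Z -> semi_kelley Z.

End Continua.

(* Main.v *)
Require Import Defs.
From mathcomp Require Import all_boot all_order all_algebra.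
From mathcomp Require Import all_classical all_reals all_analysis.
From mathcomp Require Import lra.

(* Write [x, y] for the arc from x to y, and call a bad for b when a is        *)
(* distinct from b and is a limit of points of arcs [b, b_n] with b_n tending  *)
(* to b.  The dendroid is smooth at p as soon as a lies on [p, b] whenever a   *)
(* is bad for b.  Fix q; if the points a that are bad for some b and lie off   *)
(* [q, b] form a chain for the order of the arcs issued from q, then the       *)
(* supremum of this chain is such a p.                                         *)
(*   Two incomparable points of that kind give two families of arms, attached  *)
(* to a common subcontinuum G and accumulating on an arc [s, t] from opposite  *)
(* sides.  Let Z be the closure of the union of G and of arms chosen           *)
(* alternately in both families.  As Z is semi-Kelley, the maximal limit       *)
(* continua of [s, t] through s and t are comparable, so some arm stays near   *)
(* [s, t] while joining its endpoint to a point w which is close to t (or s)   *)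
(* and is separated by G from the other arms: limits of arms fold.  Folding    *)
(* can be repeated near w, each time with one more oscillation of [q, w]       *)
(* between two separated open sets A and O, and Baire's theorem then yields a  *)
(* single arc that oscillates infinitely often, contradicting continuity.      *)

(** Limits are taken along a nonprincipal ultrafilter, so that every sequence of continua in X has a
    limit, [ulim]. The limit of the arcs [p, x_n] always contains [p, x] when x_n tends to x
    ([seg_ulim]), and a point of it off [p, x] is bad for x; this is the smoothness criterion used
    in [smooth_dendroid]. The chain property is [bad_conflict], the supremum [chain_sup]. In
    [bad_conflict], [first_entrance] cuts the arms where they come close to a chosen point,
    [opposite_continua] shows that the two cut families face each other, [semi_kelley_branch] turns
    them into a fold, and [no_fold] excludes folds. The semi-Kelley property is applied in
    [semi_kelley_extend]; the connectedness of intersections of subcontinua acts through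
    [seg_sub]. *)

Set Implicit Arguments.
Unset Strict Implicit.
Unset Printing Implicit Defensive.

Import Order.TTheory GRing.Theory Num.Theory.
Import numFieldNormedType.Exports.

Local Open Scope classical_set_scope.
Local Open Scope ring_scope.

(** * Metric preliminaries *)

Section Metric.
Context {R : realType} {T : metricType R}.
Implicit Types (x y z : T) (A B K X : set T).

Lemma ball_mdist x (e : R) y : ball x e y <-> mdist x y < e.
Proof. by rewrite ballEmdist. Qed.

Lemma invS_lt (e : R) : 0 < e -> exists m : nat, (m.+1%:R^-1 : R) < e.
Proof.
move=> e0; exists (Num.truncn e^-1).
rewrite -[X in _ < X]invrK ltf_pV2 ?posrE ?invr_gt0 ?ltr0n//.
exact: truncnS_gt.
Qed.

Lemma invS_gt0 (m : nat) : 0 < (m.+1%:R^-1 : R).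
Proof. by rewrite invr_gt0 ltr0n. Qed.

Lemma invS_le (m n : nat) : (m <= n)%N -> (n.+1%:R^-1 : R) <= m.+1%:R^-1.
Proof. by move=> mn; rewrite lef_pV2 ?posrE ?ltr0n// ler_nat. Qed.

Lemma closedmP A : (forall x, (forall e, 0 < e -> exists2 y, A y & mdist x y < e) -> A x) ->
  closed A.
Proof.
move=> h x clx; apply: h => e e0.
have [y [Ay xy]] := clx _ (nbhsx_ballx x e e0).
by exists y => //; apply/ball_mdist.
Qed.

Lemma closureP A x : closure A x <-> forall e, 0 < e -> exists2 y, A y & mdist x y < e.
Proof.
split=> [clx e e0|h].
  have [y [Ay xy]] := clx _ (nbhsx_ballx x e e0).
  by exists y => //; apply/ball_mdist.
move=> B /nbhs_ballP[e /= e0 xeB]; have [y Ay xy] := h e e0.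
by exists y; split => //; apply: xeB; apply/ball_mdist.
Qed.

Lemma closed_far A x : closed A -> ~ A x -> exists2 e, 0 < e & forall y, A y -> e <= mdist x y.
Proof.
move=> cA nAx; apply: contrapT => h; apply: nAx; apply: cA; apply/closureP => e e0.
apply: contrapT => h2; apply: h; exists e => // y Ay; rewrite leNgt; apply/negP => xy.
by apply: h2; exists y.
Qed.

Lemma compact_closed_m A : compact A -> closed A.
Proof. exact: compact_closed (@metric_hausdorff _ T). Qed.

End Metric.

(** * Limits along an ultrafilter *)

Section Ultra.
Context {R : realType} {T : metricType R}.
Context (U : set_system nat) {UU : UltraFilter U} (Uoo : \oo `<=` U).
Implicit Types (x y z : T) (A B K X : set T) (u v : nat -> T) (F G : nat -> set T).

Lemma U_ge (m : nat) : U [set n | (m <= n)%N].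
Proof. by apply: Uoo; exists m. Qed.

Lemma U_inh (P : set nat) : U P -> exists n, P n.
Proof. by move=> /filter_ex. Qed.

Lemma U_not (P : set nat) : ~ U P -> U [set n | ~ P n].
Proof. by move=> nP; have [//|] := in_ultra_setVsetC P UU. Qed.

Lemma U_or (P Q : set nat) : U [set n | P n \/ Q n] -> U P \/ U Q.
Proof.
move=> h; have [?|nP] := pselect (U P); [by left|right].
by move: h (U_not nP); apply: filterS2 => n /= [].
Qed.

Definition ucvg u x := forall e : R, 0 < e -> U [set n | mdist (u n) x < e].

(** The Kuratowski limit along [U]: as [U] is an ultrafilter, the upper and lower limits agree, and
    no convergent subsequence has to be extracted. *)
Definition ulim F : set T :=
  [set x | forall e : R, 0 < e -> U [set n | exists2 y, F n y & mdist x y < e]].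

Lemma cvg_ucvg u x : u n @[n --> \oo] --> x -> ucvg u x.
Proof.
move=> /cvg_ballP xx e e0; apply: Uoo; apply: filterS (xx e e0) => n /= h.
by rewrite metric_sym; apply/ball_mdist.
Qed.

Lemma ucvg_cst x : ucvg (fun=> x) x.
Proof. by move=> e e0; apply: filterS filterT => n _ /=; rewrite mdistxx. Qed.

Lemma ucvg_exists X u : compact X -> (forall n, X (u n)) -> exists2 x, X x & ucvg u x.
Proof.
move=> cX Xx; have FX : U (u @^-1` X) by apply: filterS filterT => n _; exact: Xx.
have [x [Xx0 clx]] := cX (u @ U) _ FX.
exists x => // e e0; have [//|h] := in_ultra_setVsetC [set n | mdist (u n) x < e] UU.
have [y [ny /ball_mdist xy]] := clx _ _ (h : (u @ U) [set y | ~ mdist y x < e]) (nbhsx_ballx x e e0).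
by case: ny; rewrite metric_sym.
Qed.

Lemma ucvg_unique u x y : ucvg u x -> ucvg u y -> x = y.
Proof.
move=> hx hy; apply: mdist_positivity; apply/eqP; rewrite eq_le mdist_ge0 andbT leNgt.
apply/negP => xy; have xy2 : 0 < mdist x y / 2 by rewrite divr_gt0.
have [n [h1 h2]] := U_inh (filterI (hx _ xy2) (hy _ xy2)).
have := metric_triangle x (u n) y; rewrite (metric_sym x (u n)); move: h1 h2 => /=; lra.
Qed.

Lemma ucvg_near u v x : ucvg u x -> (forall e : R, 0 < e -> U [set n | mdist (v n) (u n) < e]) ->
  ucvg v x.
Proof.
move=> hx hy e e0; have e2 : 0 < e / 2 by rewrite divr_gt0.
move: (hx _ e2) (hy _ e2); apply: filterS2 => n /= h1 h2.
have := metric_triangle (v n) (u n) x; lra.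
Qed.

Lemma ucvg_eq u v x : U [set n | u n = v n] -> ucvg u x -> ucvg v x.
Proof. by move=> h hx e e0; move: h (hx _ e0); apply: filterS2 => n /= <-. Qed.

Lemma ulim_ucvg F u x : U [set n | F n (u n)] -> ucvg u x -> ulim F x.
Proof.
move=> hA hx e e0; move: hA (hx _ e0); apply: filterS2 => n /= h1 h2.
by exists (u n) => //; rewrite metric_sym.
Qed.

Lemma ulim_sub F G : U [set n | F n `<=` G n] -> ulim F `<=` ulim G.
Proof.
by move=> h x hx e e0; move: h (hx _ e0); apply: filterS2 => n /= h [y /h Ay xy]; exists y.
Qed.

Lemma ulim_closed F : closed (ulim F).
Proof.
apply: closedmP => x h e e0; have e2 : 0 < e / 2 by rewrite divr_gt0.
have [y Ay xy] := h _ e2; apply: filterS (Ay _ e2) => n [z Az yz]; exists z => //.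
have := metric_triangle x y z; lra.
Qed.

Lemma ucvg_closed A u x : closed A -> U [set n | A (u n)] -> ucvg u x -> A x.
Proof.
move=> cA hA hx; apply: cA; apply/closureP => e e0.
have [n [h1 h2]] := U_inh (filterI hA (hx _ e0)).
by exists (u n) => //; rewrite metric_sym.
Qed.

Lemma ulim_subset F B : closed B -> U [set n | F n `<=` B] -> ulim F `<=` B.
Proof.
move=> cB h x hx; apply: cB; apply/closureP => e e0.
have [n [h1 [y Ay xy]]] := U_inh (filterI h (hx _ e0)).
by exists y => //; apply: h1.
Qed.

(** The point taken in [F n] meets every bound 1/(m+1), [m <= n], on the distance to [x] that some
    point of [F n] meets; one sequence thus serves all radii. *)
Lemma ulim_pick F x : (forall n, F n !=set0) -> ulim F x ->
  exists2 u, forall n, F n (u n) & ucvg u x.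
Proof.
move=> A0 hx.
have h n : exists y, F n y /\ forall m, (m <= n)%N ->
    (exists2 z, F n z & mdist x z < m.+1%:R^-1) -> mdist x y < m.+1%:R^-1.
  suff: forall N, exists y, F n y /\ forall m, (m <= N)%N ->
    (exists2 z, F n z & mdist x z < m.+1%:R^-1) -> mdist x y < m.+1%:R^-1 by exact.
  elim=> [|N [y [Ay IH]]].
    have [[z Az xz]|h] := pselect (exists2 z, F n z & mdist x z < 0.+1%:R^-1).
      by exists z; split=> // m; rewrite leqn0 => /eqP ->.
    by have [z Az] := A0 n; exists z; split=> // m; rewrite leqn0 => /eqP ->.
  have [[z Az xz]|h] := pselect (exists2 z, F n z & mdist x z < N.+2%:R^-1).
    exists z; split=> // m mN _; apply: lt_le_trans xz _; exact: invS_le.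
  exists y; split=> // m; rewrite leq_eqVlt => /orP[/eqP ->|]; first by [].
  by rewrite ltnS => mN; exact: IH.
have [u hx_] := choice h; exists u; first by move=> n; case: (hx_ n).
move=> e e0; have [m me] := @invS_lt R e e0.
move: (hx _ (@invS_gt0 R m)) (U_ge m); apply: filterS2 => n /= hn mn.
by rewrite metric_sym; apply: lt_trans me; case: (hx_ n) => _; apply.
Qed.

(** Two separated pieces of the limit lie, by compactness, at some distance [r > 0]. Their
    r/3-neighbourhoods are separated, their union contains almost all [F n], and each of them meets
    almost all [F n]. *)
Lemma ulim_connected X F : compact X -> (forall n, F n `<=` X) ->
  (forall n, F n !=set0) -> (forall n, connected (F n)) -> connected (ulim F).
Proof.
move=> cX AX A0 Ac; apply: contrapT => /connectedPn[E [E0 LE [sE1 sE2]]].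
have EL b : E b `<=` ulim F by rewrite LE => x; case: b; [right|left].
have LX : ulim F `<=` X.
  by apply: ulim_subset; [exact: compact_closed_m|apply: filterS filterT => n _; exact: AX].
have [r r0 hr] : exists2 r : R, 0 < r & forall x y, E false x -> E true y -> r <= mdist x y.
  apply: contrapT => nh.
  have h (n : nat) : exists xy : T * T, [/\ E false xy.1, E true xy.2 & mdist xy.1 xy.2 < n.+1%:R^-1].
    apply: contrapT => h; apply: nh; exists n.+1%:R^-1; first exact: invS_gt0.
    move=> x y Ex Ey; rewrite leNgt; apply/negP => xy.
    by apply: h; exists (x, y).
  have [xy hxy] := choice h.
  have [x Xx hx] : exists2 x, X x & ucvg (fun n => (xy n).1) x.
    by apply: ucvg_exists cX _ => n; case: (hxy n) => /EL/LX.
  have hy : ucvg (fun n => (xy n).2) x.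
    apply: ucvg_near hx _ => e e0; have [m me] := @invS_lt R e e0.
    apply: filterS (U_ge m) => n /= mn; have [_ _ h'] := hxy n.
    rewrite metric_sym; apply: lt_trans me; apply: lt_le_trans h' _; exact: invS_le.
  have c0 : closure (E false) x.
    apply: ucvg_closed hx; first exact: closed_closure.
    by apply: filterS filterT => n _; apply: subset_closure; case: (hxy n).
  have c1 : closure (E true) x.
    apply: ucvg_closed hy; first exact: closed_closure.
    by apply: filterS filterT => n _; apply: subset_closure; case: (hxy n).
  have Lx : ulim F x.
    apply: ulim_closed; move: c0; apply: closureS; exact: EL.
  by move: Lx; rewrite LE => -[Ex|Ex]; [have : set0 x by rewrite -sE2|have : set0 x by rewrite -sE1].
pose V b := [set z | exists2 x, E b x & mdist x z < r / 3].
have VV b z w : V b z -> V (~~ b) w -> r / 3 <= mdist z w.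
  move=> [x Ex xz] [y Ey yw]; have xy : r <= mdist x y.
    by case: b Ex Ey => Ex Ey /=; [rewrite metric_sym|]; exact: hr.
  have := metric_triangle x z y; have := metric_triangle z w y.
  rewrite (metric_sym w y); lra.
have r3 : 0 < r / 3 by rewrite divr_gt0.
have h1 : U [set n | F n `<=` V false `|` V true].
  apply: contrapT => /U_not nh.
  have h (n : nat) : exists z, F n z /\ (~ (F n `<=` V false `|` V true) -> ~ (V false `|` V true) z).
    have [h|h] := pselect (F n `<=` V false `|` V true).
      by have [z Az] := A0 n; exists z; split.
    by move/existsNP : (h) => [z /not_implyP[Az nz]]; exists z.
  have [z_ hz] := choice h.
  have [z Xz hz'] : exists2 z, X z & ucvg z_ z by apply: ucvg_exists cX _ => n; case: (hz n) => /AX.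
  have Lz : ulim F z by apply: ulim_ucvg hz'; apply: filterS filterT => n _; case: (hz n).
  have [n [/= hn1 hn2]] := U_inh (filterI nh (hz' _ r3)).
  case: (hz n) => _ /(_ hn1); apply.
  by move: Lz; rewrite LE => -[Ez|Ez]; [left|right]; exists z => //; rewrite metric_sym.
have h2 b : U [set n | exists2 y, F n y & V b y].
  have [x Ex] := E0 b; apply: filterS (EL b _ Ex _ r3) => n [y Ay xy]; exists y => //.
  by exists x.
have [n [hn1 [[y0 Ay0 Vy0] [y1 Ay1 Vy1]]]] := U_inh (filterI h1 (filterI (h2 false) (h2 true))).
have sV : separated (V false) (V true).
  split; rewrite -subset0 => w [].
    move=> /closureP/(_ _ r3)[z Vz wz] Vw; have := VV _ _ _ Vz Vw; rewrite metric_sym; lra.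
  move=> Vw /closureP/(_ _ r3)[z Vz wz]; have := VV _ _ _ Vw Vz; lra.
have [h|h] := connected_subset sV hn1 (Ac n).
  by have := VV _ _ _ (h _ Ay1) Vy1; rewrite mdistxx; lra.
by have := VV _ _ _ Vy0 (h _ Ay0); rewrite mdistxx; lra.
Qed.

End Ultra.

Lemma nonprincipal_ultrafilter : exists2 U : set_system nat, UltraFilter U & \oo `<=` U.
Proof. by have [G [UG ooG]] := ultraFilterLemma (eventually_filter); exists G. Qed.

(** * Hausdorff convergence and maximal limit continua *)

Section Hausdorff.
Context {R : realType} {T : metricType R}.
Implicit Types (x y z : T) (A B K X Z M : set T) (F G : nat -> set T).

Lemma set_neighborhoodP (e : R) A x :
  set_neighborhood e A x <-> exists2 y, A y & mdist x y < e.
Proof.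
split=> [[y Ay /ball_mdist xy]|[y Ay xy]]; exists y => //; first by rewrite metric_sym.
by apply/ball_mdist; rewrite metric_sym.
Qed.

Lemma hausdorff_cvgI F A :
  (forall e : R, 0 < e -> exists N, forall n, (N <= n)%N ->
     F n `<=` set_neighborhood e A /\ A `<=` set_neighborhood e (F n)) ->
  hausdorff_cvg F A.
Proof.
move=> h; apply/cvgrPdist_le => e e0; have [N hN] := h e e0.
exists N => // n /= /hN[h1 h2]; rewrite sub0r normrN.
have lb0 : lbound [set r : R | [/\ 0 < r, F n `<=` set_neighborhood r A &
                       A `<=` set_neighborhood r (F n)]] 0.
  by move=> r /= [/ltW].
rewrite ger0_norm; last by apply: lb_le_inf => //; exists e.
by apply: ge_inf => //; exists 0.
Qed.

Lemma compact_bounded X : compact X -> exists2 D : R, 0 < D & forall x y, X x -> X y -> mdist x y < D.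
Proof.
move=> cX; apply: contrapT => nh; have [U UU Uoo] := nonprincipal_ultrafilter.
have h (n : nat) : exists p : T * T, [/\ X p.1, X p.2 & n.+1%:R <= mdist p.1 p.2].
  apply: contrapT => h; apply: nh; exists n.+1%:R; first by rewrite ltr0n.
  move=> x y Xx Xy; rewrite ltNge; apply/negP => xy; apply: h; by exists (x, y).
have [p hp] := choice h.
have [x Xx hx] : exists2 x, X x & ucvg U (fun n => (p n).1) x.
  by apply: ucvg_exists cX _ => n; case: (hp n).
have [y Xy hy] : exists2 x, X x & ucvg U (fun n => (p n).2) x.
  by apply: ucvg_exists cX _ => n; case: (hp n).
pose m := Num.truncn (mdist x y + 2).
have [n [/= [h1 h2] mn]] := U_inh (filterI (filterI (hx _ ltr01) (hy _ ltr01)) (U_ge Uoo m)).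
have [_ _] := hp n; have := metric_triangle (p n).1 x (p n).2; have := metric_triangle x y (p n).2.
rewrite (metric_sym y).
have : mdist x y + 2 < m.+1%:R by exact: truncnS_gt.
have : (m.+1%:R : R) <= n.+1%:R by rewrite ler_nat.
lra.
Qed.

(** Boundedness of [X] makes the set of admissible radii nonempty, so that [hausdorff_dist] is a
    true infimum and not a default value. *)
Lemma hausdorff_cvgE X F A : compact X -> (forall n, F n `<=` X) -> A `<=` X ->
  (forall n, F n !=set0) -> A !=set0 -> hausdorff_cvg F A ->
  forall e : R, 0 < e -> exists N, forall n, (N <= n)%N ->
     F n `<=` set_neighborhood e A /\ A `<=` set_neighborhood e (F n).
Proof.
move=> cX FX AX F0 [a Aa] /cvgrPdist_lt h e e0; have [N _ hN] := h e e0.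
exists N => n /hN /=; rewrite sub0r normrN => hn.
have [D D0 hD] := compact_bounded cX; have [b Fb] := F0 n.
have hi : has_inf [set r : R | [/\ 0 < r, F n `<=` set_neighborhood r A &
                       A `<=` set_neighborhood r (F n)]].
  split; last by exists 0 => r /= [/ltW].
  exists D; split=> // x hx; apply/set_neighborhoodP.
    by exists a => //; apply: hD; [exact: FX hx|exact: AX].
  by exists b => //; apply: hD; [exact: AX|exact: FX Fb].
have e0' : 0 < e - hausdorff_dist (F n) A.
  by rewrite subr_gt0; apply: le_lt_trans hn; exact: ler_norm.
have [r /= [r0 h1 h2] re] := inf_adherent e0' hi.
have re' : r < e by move: re; rewrite /hausdorff_dist; lra.
split=> x; [move=> /h1|move=> /h2] => /set_neighborhoodP[y ? xy]; apply/set_neighborhoodP.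
  by exists y => //; exact: lt_trans xy _.
by exists y => //; exact: lt_trans xy _.
Qed.

Section Ultra2.
Context (U : set_system nat) {UU : UltraFilter U} (Uoo : \oo `<=` U).

(** Together with [ulim_lower]: inside a compact set, [ulim] is a Hausdorff limit along [U]. Points
    of [F n] violating the inclusion would have a limit, and it would belong to [ulim U F]. *)
Lemma ulim_upper X F (e : R) : compact X -> (forall n, F n `<=` X) -> 0 < e ->
  U [set n | F n `<=` set_neighborhood e (ulim U F)].
Proof.
move=> cX FX e0; apply: contrapT => /U_not nh.
have [n0 /existsNP[w0 /not_implyP[Fw0 _]]] := U_inh nh.
have h (n : nat) : exists z, X z /\ (~ F n `<=` set_neighborhood e (ulim U F) ->
    F n z /\ ~ set_neighborhood e (ulim U F) z).
  have [h|h] := pselect (F n `<=` set_neighborhood e (ulim U F)).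
    by exists w0; split=> //; exact: FX Fw0.
  by move/existsNP : (h) => [z /not_implyP[Az nz]]; exists z; split => //; exact: FX Az.
have [z_ hz] := choice h.
have [z Xz hz'] : exists2 z, X z & ucvg U z_ z by apply: ucvg_exists cX _ => n; case: (hz n).
have Lz : ulim U F z.
  by apply: ulim_ucvg hz'; apply: filterS nh => n hn; case: (hz n) => _ /(_ hn)[].
have [n [/= hn1 hn2]] := U_inh (filterI nh (hz' _ e0)).
case: (hz n) => _ /(_ hn1)[_]; apply; apply/set_neighborhoodP.
by exists z.
Qed.

Lemma ulim_lower X F (e : R) : compact X -> (forall n, F n `<=` X) -> 0 < e ->
  U [set n | ulim U F `<=` set_neighborhood e (F n)].
Proof.
move=> cX FX e0; apply: contrapT => /U_not nh.
have [n0 /existsNP[w0 /not_implyP[Fw0 _]]] := U_inh nh.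
have h (n : nat) : exists z, ulim U F z /\ (~ ulim U F `<=` set_neighborhood e (F n) ->
    ~ set_neighborhood e (F n) z).
  have [h|h] := pselect (ulim U F `<=` set_neighborhood e (F n)); first by exists w0.
  by move/existsNP : (h) => [z /not_implyP[Az nz]]; exists z.
have [z_ hz] := choice h.
have LX : ulim U F `<=` X.
  by apply: ulim_subset; [exact: compact_closed_m|apply: filterS filterT => n _; exact: FX].
have [z Xz hz'] : exists2 z, X z & ucvg U z_ z.
  by apply: ucvg_exists cX _ => n; case: (hz n) => /LX.
have Lz : ulim U F z.
  apply: ucvg_closed hz'; first exact: ulim_closed.
  by apply: filterS filterT => n _; case: (hz n).
have e2 : 0 < e / 2 by rewrite divr_gt0.
have [n [/= [hn1 hn2] [y Fy zy]]] := U_inh (filterI (filterI nh (hz' _ e2)) (Lz _ e2)).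
case: (hz n) => _ /(_ hn1); apply; apply/set_neighborhoodP.
by exists y => //; have := metric_triangle (z_ n) z y; lra.
Qed.

End Ultra2.

Lemma closure_neighborhood_sub (e r : R) K : e < r ->
  closure (set_neighborhood e K) `<=` set_neighborhood r K.
Proof.
move=> er x /closureP/(_ (r - e)); rewrite subr_gt0 => /(_ er)[y /set_neighborhoodP[z Kz yz] xy].
by apply/set_neighborhoodP; exists z => //; have := metric_triangle x y z; lra.
Qed.

Lemma set_neighborhood_mono (e r : R) K : e <= r -> set_neighborhood e K `<=` set_neighborhood r K.
Proof.
by move=> er x /set_neighborhoodP[y Ky xy]; apply/set_neighborhoodP; exists y => //; exact: lt_le_trans xy er.
Qed.

Lemma set_neighborhood_sub (e : R) A B : A `<=` B -> set_neighborhood e A `<=` set_neighborhood e B.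
Proof. by move=> AB x /set_neighborhoodP[y /AB By xy]; apply/set_neighborhoodP; exists y. Qed.

(* M is the intersection over j of the limits of the components at u n of the  *)
(* part of Z within 1/(j+1) of K: larger continua converging into K cannot     *)
(* leave these components.                                                     *)
Lemma maximal_limit_exists Z K (s : T) (u : nat -> T) :
  compact Z -> subcontinuum Z K -> K s -> (forall n, Z (u n)) ->
  (forall e : R, 0 < e -> exists N, forall n, (N <= n)%N -> mdist (u n) s < e) ->
  exists M, [/\ maximal_limit_continuum Z K M, M s &
    forall t (d : R), M t -> 0 < d -> exists n (C : set T),
      [/\ connected C, C (u n), C `<=` Z, C `<=` set_neighborhood d K &
          exists2 w, C w & mdist t w < d]].
Proof.
move=> cZ [KZ K0 cK Kc] Ks Zu us; have [U UU Uoo] := nonprincipal_ultrafilter.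
pose e_ (j : nat) : R := j.+1%:R^-1.
have e_gt0 j : 0 < e_ j by exact: invS_gt0.
pose N j := closure (set_neighborhood (e_ j) K).
pose C n j := connected_component (Z `&` N j) (u n).
have Zcl : closed Z by exact: compact_closed_m.
have CZ n j : C n j `<=` Z by move=> x /connected_component_sub[].
have CN n j : C n j `<=` N j by move=> x /connected_component_sub[].
have Ccl n j : closed (C n j) by apply: component_closed; apply: closedI => //; exact: closed_closure.
have Cmono n i j : (i <= j)%N -> C n j `<=` C n i.
  move=> ij x [B [Bu BZ Bc] Bx]; exists B => //; split=> // y /BZ[Zy Ny]; split=> //.
  by move: Ny; apply: closureS; apply: set_neighborhood_mono; exact: invS_le.
pose L j := ulim U (C^~ j).
have Lmono i j : (i <= j)%N -> L j `<=` L i.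
  by move=> ij; apply: ulim_sub; apply: filterS filterT => n _; exact: Cmono.
have LZ j : L j `<=` Z by apply: ulim_subset => //; apply: filterS filterT => n _; exact: CZ.
(* A diagonal index: [k i] serves all levels [j <= i] at once, so that the single sequence
   [C (k i) i] converges to the intersection of the [L j]. *)
have /choice[k hk] : forall i, exists n : nat, [/\ mdist (u n) s < e_ i,
    (forall j, (j <= i)%N -> C n j `<=` set_neighborhood (e_ i) (L j)) &
    L i `<=` set_neighborhood (e_ i) (C n i)].
  move=> i.
  have h1 : U [set n | mdist (u n) s < e_ i].
    by have [N0 hN0] := us _ (e_gt0 i); apply: filterS (U_ge Uoo N0).
  have h2 : forall m, U [set n | forall j, (j <= m)%N -> C n j `<=` set_neighborhood (e_ i) (L j)].
    elim=> [|m IH] /=.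
      apply: filterS (ulim_upper (F := C^~ 0%N) cZ (CZ^~ 0%N) (e_gt0 i)) => n /= hn j j0.
      by have -> : j = 0%N by apply/eqP; rewrite -leqn0.
    have hm1 : U [set n | C n m.+1 `<=` set_neighborhood (e_ i) (L m.+1)].
      exact: (ulim_upper (F := C^~ m.+1) cZ (CZ^~ m.+1)).
    move: IH hm1; apply: filterS2 => n /= IH hn j jm.
    have [jm'|jm'] := leqP j m; first exact: IH.
    by have -> : j = m.+1 by apply/eqP; rewrite eqn_leq jm jm'.
  have [n [[a b] c]] := U_inh (filterI (filterI h1 (h2 i)) (ulim_lower (F := C^~ i) cZ (CZ^~ i) (e_gt0 i))).
  by exists n.
pose M_ i := C (k i) i; pose M := \bigcap_j L j.
have Mu i : M_ i (u (k i)).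
  apply: connected_component_refl; split=> //; apply: subset_closure; apply/set_neighborhoodP.
  by exists s => //; case: (hk i).
have MZ : M `<=` Z by move=> x /(_ 0%N I)/LZ.
have Mcl : closed M by apply: closed_bigI => j _; exact: ulim_closed.
have Msmall (e : R) : 0 < e -> exists j, L j `<=` set_neighborhood e M.
  move=> e0; apply: contrapT => nh.
  have h (j : nat) : exists z, L j z /\ ~ set_neighborhood e M z.
    apply: contrapT => h; apply: nh; exists j => x Lx; apply: contrapT => nx.
    by apply: h; exists x.
  have [z_ hz] := choice h.
  have [z Zz hz'] : exists2 z, Z z & ucvg U z_ z.
    by apply: ucvg_exists cZ _ => n; case: (hz n) => /LZ.
  have Mz : M z.
    move=> j _; apply: ucvg_closed hz'; first exact: ulim_closed.
    by apply: filterS (U_ge Uoo j) => n /= jn; case: (hz n) => /(Lmono _ _ jn).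
  have [n hn] := U_inh (hz' _ e0).
  by case: (hz n) => _; apply; apply/set_neighborhoodP; exists z.
have Mcvg (e : R) : 0 < e -> exists N, forall n, (N <= n)%N ->
     M_ n `<=` set_neighborhood e M /\ M `<=` set_neighborhood e (M_ n).
  move=> e0; have e2 : 0 < e / 2 by rewrite divr_gt0.
  have [j hj] := Msmall _ e2; have [m hm] := @invS_lt R _ e2.
  exists (maxn j m) => n; rewrite geq_max => /andP[jn mn]; have [_ h1 h2] := hk n.
  have en : e_ n < e / 2 by apply: le_lt_trans hm; exact: invS_le.
  split=> x.
    move=> /(Cmono _ _ _ jn)/(h1 _ jn)/set_neighborhoodP[y /hj/set_neighborhoodP[z Mz yz] xy].
    by apply/set_neighborhoodP; exists z => //; have := metric_triangle x y z; lra.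
  move=> /(_ n I)/h2; apply: set_neighborhood_mono; lra.
(* Presenting [M] as a limit along [U] gives its connectedness, through [ulim_connected]. *)
have Mul : M = ulim U M_.
  apply/seteqP; split=> x.
    move=> Mx e e0; have [N0 hN0] := Mcvg _ e0.
    by apply: filterS (U_ge Uoo N0) => n /hN0[_ /(_ _ Mx)/set_neighborhoodP].
  move=> hx; apply: Mcl; apply/closureP => e e0; have e2 : 0 < e / 2 by rewrite divr_gt0.
  have [N0 hN0] := Mcvg _ e2.
  have [n [/hN0[h _] [y My xy]]] := U_inh (filterI (U_ge Uoo N0) (hx _ e2)).
  have /set_neighborhoodP[z Mz yz] := h _ My.
  by exists z => //; have := metric_triangle x y z; lra.
have Ms : M s.
  move=> j _; apply: (ulim_ucvg (u := u)).
    have [N0 hN0] := us _ (e_gt0 j); apply: filterS (U_ge Uoo N0) => n /= Nn.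
    apply: connected_component_refl; split=> //; apply: subset_closure; apply/set_neighborhoodP.
    by exists s => //; exact: hN0.
  by move=> e e0; have [N0 hN0] := us _ e0; apply: filterS (U_ge Uoo N0).
have MK : M `<=` K.
  move=> x Mx; apply: (compact_closed_m cK); apply/closureP => e e0.
  have [j hj] := @invS_lt R _ e0.
  have : N j x.
    move: (Mx j I); apply: ulim_subset; first exact: closed_closure.
    by apply: filterS filterT => n _; exact: CN.
  by move=> /(closure_neighborhood_sub hj)/set_neighborhoodP.
have M0 : M !=set0 by exists s.
have cM : compact M by apply: subclosed_compact cZ MZ.
have Mc : connected M.
  rewrite Mul; apply: (ulim_connected Uoo cZ) => n; first exact: CZ.
    by exists (u (k n)).
  exact: component_connected.
exists M; split=> //.
- split; first by split.
  exists M_; split.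
  + move=> n; split; [exact: CZ|by exists (u (k n))| |exact: component_connected].
    by apply: subclosed_compact cZ (@CZ _ _).
  + exact: hausdorff_cvgI.
  + move=> F M' Fs MF [M'Z M'0 cM' M'c] FM' M'K.
    have FZ n : F n `<=` Z by case: (Fs n).
    have F0 n : F n !=set0 by case: (Fs n).
    have h := hausdorff_cvgE cZ FZ M'Z F0 M'0 FM'.
    apply/seteqP; split=> x; last first.
      move=> Mx; apply: (compact_closed_m cM'); apply/closureP => e e0.
      have e2 : 0 < e / 2 by rewrite divr_gt0.
      have [N1 h1] := h _ e2; have [N2 h2] := Mcvg _ e2.
      have [/(_ _ _)h3 _] := h1 _ (leq_maxl N1 N2); have [_ h4] := h2 _ (leq_maxr N1 N2).
      have /set_neighborhoodP[y /MF Fy xy] := h4 _ Mx.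
      have /set_neighborhoodP[z Mz yz] := h3 _ Fy.
      by exists z => //; have := metric_triangle x y z; lra.
    move=> M'x j _; apply: ulim_closed; apply/closureP => e e0.
    have e2 : 0 < e / 2 by rewrite divr_gt0.
    have [N1 h1] := h _ e2; have [N2 h2] := h _ (e_gt0 j); have [m hm] := @invS_lt R _ e2.
    pose n := maxn (maxn N1 N2) (maxn j m).
    have [_ h3] := h1 n (leq_trans (leq_maxl N1 N2) (leq_maxl _ _)).
    have [h4 _] := h2 n (leq_trans (leq_maxr N1 N2) (leq_maxl _ _)).
    have jn : (j <= n)%N by exact: leq_trans (leq_maxl j m) (leq_maxr _ _).
    have mn : (m <= n)%N by exact: leq_trans (leq_maxr j m) (leq_maxr _ _).
    have /set_neighborhoodP[y Fy xy] := h3 _ M'x.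
    have FC : F n `<=` C (k n) j.
      have [_ _ _ Fc] := Fs n.
      apply: connected_component_max Fc; first exact: MF.
      move=> z Fz; split; first exact: FZ Fz.
      apply: subset_closure; move: (h4 _ Fz); exact: set_neighborhood_sub.
    have [_ h5 _] := hk n; have /set_neighborhoodP[z Lz yz] := h5 _ jn _ (FC _ Fy).
    have en : e_ n < e / 2 by apply: le_lt_trans hm; exact: invS_le.
    by exists z => //; have := metric_triangle x y z; lra.
- move=> t d Mt d0; have [j hj] := @invS_lt R _ d0.
  have [N0 hN0] := us _ (e_gt0 j).
  have [n [/= Nn [y Cy ty]]] := U_inh (filterI (U_ge Uoo N0) (Mt j I _ d0)).
  exists n, (C n j); split; [exact: component_connected| |exact: CZ| |by exists y].
    apply: connected_component_refl; split=> //; apply: subset_closure; apply/set_neighborhoodP.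
    by exists s => //; exact: hN0.
  by move=> x /CN; exact: closure_neighborhood_sub.
Qed.

(** Of the maximal limit continua of [K] obtained through [s] and through [t], one contains the
    other, hence both points. Connected sets close to [K] therefore join some [u n] to a point near
    [t], or some [v n] to a point near [s]. *)
Lemma semi_kelley_extend Z K (s t : T) (u v : nat -> T) (d : R) :
  compact Z -> semi_kelley Z -> subcontinuum Z K -> K s -> K t -> 0 < d ->
  (forall n, Z (u n)) -> (forall n, Z (v n)) ->
  (forall e : R, 0 < e -> exists N, forall n, (N <= n)%N -> mdist (u n) s < e) ->
  (forall e : R, 0 < e -> exists N, forall n, (N <= n)%N -> mdist (v n) t < e) ->
  exists n (C : set T), [/\ connected C, C `<=` Z, C `<=` set_neighborhood d K &
    (C (u n) /\ exists2 w, C w & mdist t w < d) \/ (C (v n) /\ exists2 w, C w & mdist s w < d)].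
Proof.
move=> cZ kZ sK Ks Kt d0 Zu Zv us vt.
have [M [hM Ms Mh]] := maximal_limit_exists cZ sK Ks Zu us.
have [L [hL Lt Lh]] := maximal_limit_exists cZ sK Kt Zv vt.
have [h|h] := kZ _ sK _ _ hM hL.
  have [n [C [? ? ? ? ?]]] := Lh s d (h _ Ms) d0.
  by exists n, C; split=> //; right.
have [n [C [? ? ? ? ?]]] := Mh t d (h _ Lt) d0.
by exists n, C; split=> //; left.
Qed.

End Hausdorff.

Lemma within_continuousRT {R : realType} {T : metricType R} (A : set R) (f : R -> T) :
  {within A, continuous f} -> forall x, A x -> forall e : R, 0 < e ->
  exists2 d : R, 0 < d & forall y, A y -> `|x - y| < d -> mdist (f x) (f y) < e.
Proof.
move=> /subspace_continuousP h x Ax e e0.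
have /= /nbhs_ballP[d /= d0 hd] := h x Ax _ (nbhsx_ballx (f x) e e0).
by exists d => // y Ay xy; have /ball_mdist := hd y xy Ay.
Qed.

Lemma within_continuousTR {R : realType} {T : metricType R} (A : set T) (f : T -> R) :
  {within A, continuous f} -> forall x, A x -> forall e : R, 0 < e ->
  exists2 d : R, 0 < d & forall y, A y -> mdist x y < d -> `|f x - f y| < e.
Proof.
move=> /subspace_continuousP h x Ax e e0.
have /= /nbhs_ballP[d /= d0 hd] := h x Ax _ (nbhsx_ballx (f x) e e0).
by exists d => // y Ay xy; apply: hd => //; apply/ball_mdist.
Qed.

Lemma ball_open_m {R : realType} {T : metricType R} (x : T) (e : R) : open (ball x e).
Proof.
rewrite openE => y /ball_mdist xy; apply/nbhs_ballP.
exists (e - mdist x y); rewrite /= ?subr_gt0// => z /ball_mdist yz; apply/ball_mdist.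
by have := metric_triangle x y z; lra.
Qed.

(** * Arcs of a dendroid *)

Section Segments.
Context {R : realType} {T : metricType R} (X : set T) (hX : dendroid X).
Implicit Types (a b c d x y z : T) (A B K F : set T).

Notation seg := (arc_of X).

Let cX : compact X. Proof. by case: hX => [[]]. Qed.

Lemma subcontinuumU A B : subcontinuum X A -> subcontinuum X B -> A `&` B !=set0 ->
  subcontinuum X (A `|` B).
Proof.
move=> [AX [a Aa] cA Ac] [BX _ cB Bc] AB; split.
- by rewrite subUset.
- by exists a; left.
- exact: compactU.
- exact: connectedU.
Qed.

Lemma segxx a : seg a a = [set a].
Proof. by rewrite /arc_of eqxx. Qed.

(** The last clause holds because the inverse of the parametrization maps a connected subset of the
    arc onto an interval. *)
Lemma seg_param a b : X a -> X b -> a <> b -> exists f : R -> T,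
  [/\ {within `[0, 1], continuous f}, f 0 = a, f 1 = b, seg a b = f @` `[0, 1] &
  [/\ seg a b `<=` X,
   (forall s t, 0 <= s <= 1 -> 0 <= t <= 1 -> f s = f t -> s = t) ,
   (exists g : T -> R, {within seg a b, continuous g} /\ forall t, 0 <= t <= 1 -> g (f t) = t) &
  forall B s t r, B `<=` seg a b -> connected B -> B (f s) -> B (f t) ->
    0 <= s -> t <= 1 -> s <= r <= t -> B (f r)]].
Proof.
move=> Xa Xb ab; have [_ /(_ _ _ Xa Xb ab)[A0 A0X A0p] _] := hX.
have -> : seg a b = xget set0 [set A | A `<=` X /\ arc_with_endpoints a b A].
  by rewrite /arc_of; case: eqP.
have [AX [f [[[fA fi fs] fc [g gK gc]] f0 f1]]] :
    [set A | A `<=` X /\ arc_with_endpoints a b A] (xget set0 [set A | A `<=` X /\ arc_with_endpoints a b A]).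
  by apply: xgetPex; exists A0; split.
set A := xget _ _ in AX fA fi fs fc gK gc *.
have gK' t : 0 <= t <= 1 -> g (f t) = t.
  by move=> t01; apply: gK; rewrite inE /= in_itv /=.
exists f; split=> //.
  apply/seteqP; split=> [x /fs[t t01 <-]|x [t t01 <-]]; first by exists t.
  exact: fA.
split=> //.
- by move=> s t s01 t01 fst; rewrite -(gK' s)// fst gK'.
- by exists g; split.
- move=> B s t r BA Bc Bs Bt s0 t1 /andP[sr rt].
  have : connected (g @` B).
    by apply: connected_continuous_connected => //; apply: continuous_subspaceW gc.
  have s01 : 0 <= s <= 1 by rewrite s0 /=; apply: le_trans sr _; exact: le_trans rt t1.
  have t01 : 0 <= t <= 1 by rewrite t1 andbT; apply: le_trans s0 _; exact: le_trans sr rt.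
  have r01 : 0 <= r <= 1 by apply/andP; split; [exact: le_trans s0 sr|exact: le_trans rt t1].
  move=> /connected_intervalP/(_ s t) h.
  have gs : (g @` B) s by exists (f s) => //; exact: gK'.
  have gt : (g @` B) t by exists (f t) => //; exact: gK'.
  have [x Bx gx] : (g @` B) r by apply: h => //; rewrite sr rt.
  have [q] := fs _ (BA _ Bx); rewrite /= in_itv /= => q01 fq.
  by move: gx; rewrite -fq gK'// => <-; rewrite fq.
Qed.

(** The intersection of [K] with the arc is connected and contains both ends, so it is the whole
    arc. This is the main tool below: an arc is located by exhibiting a continuum through its
    ends. *)
Lemma seg_sub a b K : subcontinuum X K -> K a -> K b -> seg a b `<=` K.
Proof.
move=> sK Ka Kb; have [<-|ab] := pselect (a = b); first by rewrite segxx => _ ->.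
have [KX _ cK Kc] := sK; have Xa := KX _ Ka; have Xb := KX _ Kb.
have [f [fc f0 f1 sE [sX fi _ h]]] := seg_param Xa Xb ab.
have sS : subcontinuum X (seg a b).
  split=> //.
  - by exists a; rewrite sE; exists 0 => //=; rewrite in_itv /= lexx ler01.
  - by rewrite sE; apply: continuous_compact => //; exact: segment_compact.
  - by rewrite sE; apply: connected_continuous_connected => //; apply/connected_intervalP; exact: interval_is_interval.
have [_ _ /(_ _ _ sK sS)KS] := hX.
move=> x; rewrite {1}sE => -[t /=]; rewrite in_itv /= => t01 <-.
have saE : seg a b a by rewrite sE; exists 0 => //=; rewrite in_itv /= lexx ler01.
have sbE : seg a b b by rewrite sE; exists 1 => //=; rewrite in_itv /= lexx ler01.
have [] // : (K `&` seg a b) (f t).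
by apply: (h _ 0 1) => //; [rewrite f0|rewrite f1].
Qed.

Lemma seg_cont a b : X a -> X b -> subcontinuum X (seg a b).
Proof.
move=> Xa Xb; have [<-|ab] := pselect (a = b).
  rewrite segxx; split; [by move=> _ ->|by exists a|exact: compact_set1|exact: connected1].
have [f [fc f0 f1 sE [sX fi _ h]]] := seg_param Xa Xb ab.
split=> //.
- by exists a; rewrite sE; exists 0 => //=; rewrite in_itv /= lexx ler01.
- by rewrite sE; apply: continuous_compact => //; exact: segment_compact.
- by rewrite sE; apply: connected_continuous_connected => //; apply/connected_intervalP; exact: interval_is_interval.
Qed.

Lemma segX a b : X a -> X b -> seg a b `<=` X.
Proof. by move=> Xa Xb; case: (seg_cont Xa Xb). Qed.

Lemma seg_connected a b : X a -> X b -> connected (seg a b).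
Proof. by move=> Xa Xb; case: (seg_cont Xa Xb). Qed.

Lemma seg_closed a b : X a -> X b -> closed (seg a b).
Proof. by move=> Xa Xb; apply: compact_closed_m; case: (seg_cont Xa Xb). Qed.

Lemma segl a b : X a -> X b -> seg a b a.
Proof.
move=> Xa Xb; have [<-|ab] := pselect (a = b); first by rewrite segxx.
have [f [_ f0 _ -> _]] := seg_param Xa Xb ab.
by exists 0 => //=; rewrite in_itv /= lexx ler01.
Qed.

Lemma segr a b : X a -> X b -> seg a b b.
Proof.
move=> Xa Xb; have [<-|ab] := pselect (a = b); first by rewrite segxx.
have [f [_ _ f1 -> _]] := seg_param Xa Xb ab.
by exists 1 => //=; rewrite in_itv /= lexx ler01.
Qed.

Lemma seg_subseg a b c d : X a -> X b -> seg a b c -> seg a b d -> seg c d `<=` seg a b.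
Proof. by move=> Xa Xb ? ?; apply: seg_sub => //; exact: seg_cont. Qed.

Lemma segC a b : X a -> X b -> seg a b = seg b a.
Proof.
move=> Xa Xb; apply/seteqP; split; apply: seg_sub; do ?exact: seg_cont; do ?exact: segl; exact: segr.
Qed.

Lemma seg_tri c a b : X a -> X b -> X c -> seg a b `<=` seg a c `|` seg c b.
Proof.
move=> Xa Xb Xc; apply: seg_sub.
- apply: subcontinuumU; [exact: seg_cont|exact: seg_cont|].
  by exists c; split; [exact: segr|exact: segl].
- by left; exact: segl.
- by right; exact: segr.
Qed.

(** The image of the parameter interval from [s] to [t] is a continuum, so it contains the subarc by
    [seg_sub]; [seg_param] gives the other inclusion. Betweenness becomes the order of real
    parameters. *)
Lemma seg_order a b : X a -> X b -> a <> b -> exists f : R -> T,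
  [/\ {within `[0, 1], continuous f}, f 0 = a, f 1 = b,
   (forall x, seg a b x <-> exists2 t, 0 <= t <= 1 & f t = x) &
  [/\ (forall s t, 0 <= s <= 1 -> 0 <= t <= 1 -> f s = f t -> s = t) ,
   (exists g : T -> R, {within seg a b, continuous g} /\ forall t, 0 <= t <= 1 -> g (f t) = t) &
   forall s t r, 0 <= s -> s <= t -> t <= 1 -> 0 <= r <= 1 -> (seg (f s) (f t) (f r) <-> s <= r <= t)]].
Proof.
move=> Xa Xb ab; have [f [fc f0 f1 sE [sX fi fg h]]] := seg_param Xa Xb ab.
have sP x : seg a b x <-> exists2 t, 0 <= t <= 1 & f t = x.
  by rewrite sE; split=> -[t]; [rewrite /= in_itv /= => ? ?; exists t|move=> ? ?; exists t => //=; rewrite in_itv].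
exists f; split=> //; split=> // s t r s0 st t1 r01.
have s01 : 0 <= s <= 1 by rewrite s0 /=; exact: le_trans st t1.
have t01 : 0 <= t <= 1 by rewrite t1 andbT; exact: le_trans s0 st.
have Ss : seg a b (f s) by apply/sP; exists s.
have St : seg a b (f t) by apply/sP; exists t.
have Xs := segX Xa Xb Ss; have Xt := segX Xa Xb St.
split; last first.
  move=> srt; apply: (h _ s t) => //; [exact: seg_subseg|exact: seg_connected|exact: segl|exact: segr].
have : seg (f s) (f t) `<=` f @` `[s, t].
  have sub : `[s, t] `<=` (`[0, 1] : set R).
    move=> q /=; rewrite !in_itv /= => /andP[sq qt]; apply/andP; split; [exact: le_trans s0 sq|exact: le_trans qt t1].
  have fc' : {within `[s, t], continuous f} by exact: continuous_subspaceW fc.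
  apply: seg_sub.
  - split.
    + by move=> _ [q /sub q01 <-]; apply: sX; rewrite sE; exists q.
    + by exists (f s), s => //=; rewrite in_itv /= lexx.
    + by apply: continuous_compact => //; exact: segment_compact.
    + by apply: connected_continuous_connected => //; apply/connected_intervalP; exact: interval_is_interval.
  - by exists s => //=; rewrite in_itv /= lexx.
  - by exists t => //=; rewrite in_itv /= lexx st.
move=> /[apply] -[q /=]; rewrite in_itv /= => /andP[sq qt] fq.
have <- : q = r by apply: fi => //; apply/andP; split; [exact: le_trans s0 sq|exact: le_trans qt t1].
by rewrite sq qt.
Qed.

(** For fixed [a], [seg a b c] is a partial order in which [c] precedes [b]: this is antisymmetry,
    [seg_trans] is transitivity, and [seg_lin] says that the predecessors of a point form a
    chain. *)
Lemma seg_anti a b c : X a -> X b -> seg a b c -> seg a c b -> b = c.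
Proof.
move=> Xa Xb; have [<-|ab] := pselect (a = b); first by rewrite segxx => ->; rewrite segxx.
have [f [fc f0 f1 sP [fi _ so]]] := seg_order Xa Xb ab.
move=> /sP[s s01 <-]; rewrite -f0 -f1 => /(so 0 s 1 (lexx _)).
case/andP: (s01) => s0 s1; rewrite s0 s1 lexx ler01 => /(_ isT isT isT)/=.
by move=> s1'; congr f; apply/eqP; rewrite eq_le s1 s1'.
Qed.

Lemma seg_mid a b c d : X a -> X b -> seg a b c -> seg a c d -> seg d b c.
Proof.
move=> Xa Xb; have [<-|ab] := pselect (a = b).
  by rewrite segxx => ->; rewrite segxx => ->; rewrite segxx.
have [f [fc f0 f1 sP [fi _ so]]] := seg_order Xa Xb ab.
move=> Sc; have Xc := segX Xa Xb Sc; have /sP[s /andP[s0 s1] <-] := Sc.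
move=> Sd; have /sP[t t01 tE] : seg a b d.
  by apply: seg_subseg Sd => //; [exact: segl|apply/sP; exists s => //; rewrite s0].
case/andP: (t01) => t0 t1.
move: Sd; rewrite -tE -{1}f0 => /(so 0 s t (lexx _) s0 s1 t01) /andP[_ ts].
by rewrite -f1; apply/(so t 1 s t0 t1 (lexx _)); rewrite ?s0 ?s1 ?ts.
Qed.

Lemma seg_lin a b c d : X a -> X b -> seg a b c -> seg a b d -> seg a c d \/ seg a d c.
Proof.
move=> Xa Xb Sc Sd; have Xc := segX Xa Xb Sc; have Xd := segX Xa Xb Sd.
have [ab|ab] := pselect (a = b).
  by move: Sc Sd; rewrite ab segxx => -> ->; left; rewrite segxx.
have [f [fc f0 f1 sP [fi _ so]]] := seg_order Xa Xb ab.
move/sP : Sc => [s /andP[s0 s1] <-]; move/sP : Sd => [t /andP[t0 t1] <-].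
rewrite -f0; have [st|/ltW ts] := leP s t; [right|left].
  by apply/(so 0 t s (lexx _)); rewrite ?s0 ?s1 ?t0 ?t1.
by apply/(so 0 s t (lexx _)); rewrite ?s0 ?s1 ?t0 ?t1.
Qed.

Lemma seg_first a b F : X a -> X b -> closed F -> seg a b `&` F !=set0 ->
  exists c, [/\ seg a b c, F c & forall d, seg a c d -> F d -> d = c].
Proof.
move=> Xa Xb cF [x [Sx Fx]]; have [ab|ab] := pselect (a = b).
  by move: Sx; rewrite ab segxx => xb; exists x; split=> // d; rewrite xb segxx.
have [f [fc f0 f1 sP [fi [g [gc gK]] so]]] := seg_order Xa Xb ab.
have cSF : compact (seg a b `&` F).
  apply: subclosed_compact (_ : compact (seg a b)) _; last by move=> ? [].
    by apply: closedI => //; exact: seg_closed.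
  by case: (seg_cont Xa Xb).
have SF0 : (seg a b `&` F) !=set0 by exists x.
have gc' : {within seg a b `&` F, continuous g} by apply: continuous_subspaceW gc => ? [].
have [c /set_mem[Sc Fc] hc] := compact_EVT_min SF0 cSF gc'.
exists c; split=> // d Sd Fd; have Sd' : seg a b d by apply: seg_subseg Sd => //; exact: segl.
have := hc d (mem_set (conj Sd' Fd)).
move/sP : Sc Sd => [s s01 <-]; move/sP : Sd' => [t t01 <-]; rewrite !gK// => Sd st; move: Sd.
case/andP: (s01) => s0 s1.
rewrite -f0 => /(so 0 s t (lexx _) s0 s1 t01)/andP[_ ts].
by congr f; apply/eqP; rewrite eq_le st ts.
Qed.

(** Otherwise [b] would be an isolated point of a connected arc. *)
Lemma seg_near a b (e : R) : X a -> X b -> a <> b -> 0 < e ->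
  exists u, [/\ seg a b u, u <> a, u <> b & mdist u b < e].
Proof.
move=> Xa Xb ab e0; apply: contrapT => nh.
have ab0 : 0 < mdist a b by rewrite mdist_gt0; apply/eqP.
pose r := Num.min e (mdist a b); have r0 : 0 < r by rewrite lt_min e0 ab0.
have h : [set b] = seg a b.
  apply: (seg_connected Xa Xb).
  - by exists b.
  - exists (ball b r); first exact: ball_open_m.
    apply/seteqP; split=> [_ ->|u [Su /ball_mdist]]; first by split; [exact: segr|exact: ballxx].
    rewrite lt_min => /andP[ue ua]; apply: contrapT => ub; apply: nh; exists u; split=> //.
      by move=> uE; move: ua; rewrite uE metric_sym ltxx.
    by rewrite metric_sym.
  - exists [set b]; first by apply: compact_closed_m; exact: compact_set1.
    by apply/seteqP; split=> [_ ->|u []//]; split => //; exact: segr.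
by have := segl Xa Xb; rewrite -h.
Qed.

(** Let [g] be the first point of [G] on one arc from [x]. If another arc [x, c] missed [g], then,
    as [c, g] lies in [G], the point [g] would be all of [x, g] outside the closed set [x, c], hence
    isolated in [x, g]. *)
Lemma gate_exists (G : set T) x : subcontinuum X G -> X x -> exists2 g, G g & forall c, G c -> seg x c g.
Proof.
move=> sG Xx; have [GX [c0 Gc0] cG Gc] := sG.
have [g [Sg Gg hg]] : exists c, [/\ seg x c0 c, G c & forall d, seg x c d -> G d -> d = c].
  apply: seg_first => //; [exact: GX|exact: compact_closed_m|].
  by exists c0; split=> //; apply: segr => //; exact: GX.
have Xg := GX _ Gg; exists g => // c Gc'; have Xc := GX _ Gc'.
apply: contrapT => nSg.
have h : [set g] = seg x g.
  apply: (seg_connected Xx Xg).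
  - by exists g.
  - exists (~` seg x c); first by rewrite openC; exact: seg_closed.
    apply/seteqP; split=> [_ ->|u [Su nSu]]; first by split => //; exact: segr.
    have [//|Su'] := seg_tri Xx Xg Xc Su.
    by apply: hg => //; apply: seg_sub Su'.
  - exists [set g]; first by apply: compact_closed_m; exact: compact_set1.
    by apply/seteqP; split=> [_ ->|u []//]; split => //; exact: segr.
have := segl Xx Xg; rewrite -h /= => xg.
by apply: nSg; rewrite -xg; exact: segl.
Qed.

End Segments.

(** Transfers a property from ultrafilter limits to a metric neighbourhood: counterexamples at
    distance less than 1/(n+1) form a sequence tending to [x]. *)
Lemma ultra_bound {R : realType} {T : metricType R} (X : set T) (P : T -> Prop) (x : T) :
  X x ->
  (forall (U : set_system nat), UltraFilter U -> \oo `<=` U ->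
    forall u : nat -> T, (forall n, X (u n)) -> ucvg U u x -> U [set n | P (u n)]) ->
  exists2 e : R, 0 < e & forall y, X y -> mdist x y < e -> P y.
Proof.
move=> Xx h; apply: contrapT => nh; have [U UU Uoo] := nonprincipal_ultrafilter.
have /choice[u hu] (n : nat) : exists y, [/\ X y, mdist x y < n.+1%:R^-1 & ~ P y].
  apply: contrapT => h2; apply: nh; exists n.+1%:R^-1; first exact: invS_gt0.
  by move=> y Xy xy; apply: contrapT => nP; apply: h2; exists y.
have [||n /= Pn] := U_inh (h U UU Uoo u _ _); last by case: (hu n).
  by move=> n; case: (hu n).
move=> e e0; have [m me] := @invS_lt R e e0.
apply: filterS (U_ge Uoo m) => n /= mn; have [_ un _] := hu n.
by rewrite metric_sym; apply: lt_trans me; apply: lt_le_trans un _; exact: invS_le.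
Qed.

(** * Limits and oscillation of arcs *)

Section Dendroid.
Context {R : realType} {T : metricType R} (X : set T) (hX : dendroid X).
Implicit Types (a b c d x y z q v w : T) (A O B K F G S : set T).

Notation seg := (arc_of X).

Let cX : compact X. Proof. by case: hX => [[]]. Qed.

Lemma sub_subcontinuum K : subcontinuum X K -> K `<=` X. Proof. by case. Qed.

Section Ultra.
Context (U : set_system nat) {UU : UltraFilter U} (Uoo : \oo `<=` U).

Lemma ulim_subcontinuum (F : nat -> set T) : (forall n, subcontinuum X (F n)) ->
  subcontinuum X (ulim U F).
Proof.
move=> hF; have FX n : F n `<=` X by case: (hF n).
have F0 n : F n !=set0 by case: (hF n).
have LX : ulim U F `<=` X.
  by apply: ulim_subset; [exact: compact_closed_m|apply: filterS filterT => n _; exact: FX].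
split=> //.
- have [u hu] := choice F0; have [x _ hx] : exists2 x, X x & ucvg U u x.
    by apply: ucvg_exists => // n; exact: FX.
  by exists x; apply: ulim_ucvg hx; apply: filterS filterT => n _; exact: hu.
- by apply: subclosed_compact cX LX; exact: ulim_closed.
- by apply: ulim_connected cX FX F0 _ => // n; case: (hF n).
Qed.

Lemma seg_ulim_sub (F : nat -> set T) x y : (forall n, subcontinuum X (F n)) ->
  ulim U F x -> ulim U F y -> seg x y `<=` ulim U F.
Proof. by move=> hF; apply: seg_sub => //; exact: ulim_subcontinuum. Qed.

(** The limit of the arcs is a continuum through [x] and [y]. It may exceed [x, y]; this excess is
    what obstructs smoothness. *)
Lemma seg_ulim (u v : nat -> T) x y : (forall n, X (u n)) -> (forall n, X (v n)) ->
  ucvg U u x -> ucvg U v y -> seg x y `<=` ulim U (fun n => seg (u n) (v n)).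
Proof.
move=> Xu Xv ux vy; apply: seg_ulim_sub.
- by move=> n; exact: seg_cont.
- by apply: ulim_ucvg ux; apply: filterS filterT => n _; exact: segl.
- by apply: ulim_ucvg vy; apply: filterS filterT => n _; exact: segr.
Qed.

(* No fold occurs inside J.  Arcs are tame, whereas a general subcontinuum of  *)
(* a dendroid is not.                                                          *)
Definition tame J := forall (u : nat -> T) x, (forall n, J (u n)) -> ucvg U u x ->
  forall e : R, 0 < e -> U [set n | seg x (u n) `<=` ball x e].

Lemma tame_seg a b : X a -> X b -> tame (seg a b).
Proof.
move=> Xa Xb u x Ju ux e e0; have Jx : seg a b x.
  by apply: ucvg_closed ux; [exact: seg_closed|apply: filterS filterT => n _; exact: Ju].
have [ab|ab] := pselect (a = b).
  apply: filterS filterT => n _ /=; move: Jx (Ju n); rewrite -ab segxx => -> ->; rewrite segxx => _ ->.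
  exact: ballxx.
have [f [fc f0 f1 sP [fi [g [gc gK]] so]]] := seg_order hX Xa Xb ab.
have [t t01 ft] := (sP _).1 Jx.
have t01' : `[0, 1]%classic t by rewrite /= in_itv.
have [d d0 hd] := within_continuousRT fc t01' e0.
have [d' d'0 hd'] := within_continuousTR gc Jx d0.
apply: filterS (ux _ d'0) => n /= xn z; have [s s01 fs] := (sP _).1 (Ju n).
have := hd' _ (Ju n); rewrite metric_sym => /(_ xn); rewrite -ft -fs !gK// => ts Sz.
have Sz' : seg a b z by apply: (seg_subseg hX) Sz => //; apply/sP; [exists t|exists s].
have [r r01 fr] := (sP _).1 Sz'; apply/ball_mdist.
rewrite -fr; apply: hd; first by rewrite /= in_itv.
move: Sz; rewrite -fr; case/andP: t01 => t0 t1; case/andP: s01 => s0 s1.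
have Xx : X (f t) by rewrite ft; exact: segX Jx.
have Xu : X (f s) by rewrite fs; exact: segX (Ju n).
have [st|/ltW st] := leP t s.
  move=> /(so t s r t0 st s1 r01) /andP[tr rs]; move: ts; rewrite !ltr_norml; lra.
rewrite segC// => /(so s t r s0 st t1 r01) /andP[tr rs]; move: ts; rewrite !ltr_norml; lra.
Qed.

Lemma tameU A B : closed A -> closed B -> tame A -> tame B -> tame (A `|` B).
Proof.
move=> cA cB hA hB u x Ju ux e e0.
have key C : closed C -> tame C -> U [set n | C (u n)] -> U [set n | seg x (u n) `<=` ball x e].
  move=> cC hC UC; have Cx : C x by exact: ucvg_closed UC ux.
  (* Terms outside [C] are replaced by [x], since tameness speaks of sequences lying entirely in the
     set; along [U] nothing changes. *)
  pose u' n := if pselect (C (u n)) then u n else x.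
  have uE : U [set n | u n = u' n].
    by apply: filterS UC => n /= h; rewrite /u'; case: pselect.
  have Cu' n : C (u' n) by rewrite /u'; case: pselect.
  have ux' : ucvg U u' x by exact: ucvg_eq ux.
  have h := hC u' x Cu' ux' e e0; by apply: filterS2 uE h => n /= ->.
have : U [set n | A (u n) \/ B (u n)] by apply: filterS filterT => k _; exact: Ju.
by case/U_or; apply: key.
Qed.

End Ultra.

Section Oscillation.
Context (q : T) (A O : set T).

(* [osc m x] holds when the arc from q to x meets m points taken alternately  *)
(* in A, O, A, ... in this order.                                              *)
Fixpoint osc (m : nat) : set T :=
  if m is m'.+1 then [set x | X x /\ exists y, [/\ seg q x y, osc m' y & (if odd m' then O else A) y]]
  else X.

Context (Xq : X q).

Lemma osc_up m x x' : X x' -> seg q x' x -> osc m x -> osc m x'.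
Proof.
case: m => //= m Xx' Sx [Xx [y [Sy Oy Wy]]]; split=> //; exists y; split=> //.
by apply: (seg_subseg hX) Sy => //; exact: segl.
Qed.

Lemma osc_decr m n : (m <= n)%N -> osc n `<=` osc m.
Proof.
move=> /subnK <-; elim: (n - m)%N => [//|k IH] x.
rewrite addSn => -[Xx [y [Sy Oy _]]]; apply: IH; exact: osc_up Oy.
Qed.

(** By [seg_ulim], arcs from [q] to points near [x] pass near the last mark [y]; induction applies
    at [y], and [A] and [O] are open. *)
Lemma osc_open m x : open A -> open O -> osc m x ->
  exists2 e : R, 0 < e & forall y, X y -> mdist x y < e -> osc m y.
Proof.
move=> oA oO; elim: m x => [|m IH] x; first by exists 1.
move=> [Xx [y [Sy Oy Wy]]]; apply: (ultra_bound Xx) => U UU Uoo u Xu ux.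
have yL : ulim U (fun n => seg q (u n)) y.
  apply: seg_ulim Sy => //; exact: ucvg_cst.
have [e e0 he] := IH _ Oy.
have oW : open (if odd m then O else A) by case: ifP.
have /nbhs_ballP[e' /= e'0 he'] := open_nbhs_nbhs (conj oW Wy).
have e''0 : 0 < Num.min e e' by rewrite lt_min e0 e'0.
apply: filterS (yL _ e''0) => n [z Sz]; rewrite lt_min => /andP[ze ze']; split=> //.
exists z; split=> //; first by apply: he => //; exact: segX Sz.
by apply: he'; apply/ball_mdist.
Qed.

(** Let [s] be the infimum of the parameters on [q, x] at which all [osc m] hold. Some [osc m0]
    holds at no parameter up to [s - d], so two consecutive marks of a point just after [s] both lie
    close to [f s], although one is in [A] and the other in [O]. *)
Lemma not_osc_all x (r : R) : 0 < r -> (forall a o, A a -> O o -> r <= mdist a o) ->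
  X x -> (forall m, osc m x) -> False.
Proof.
move=> r0 AO Xx Rx.
have AOs m y y' (z : T) : (if odd m then O else A) y -> (if odd m.+1 then O else A) y' ->
    mdist z y < r / 2 -> mdist z y' < r / 2 -> False.
  move=> Wy Wy' zy zy'; have : r <= mdist y y'.
    by move: Wy Wy' => /=; case: (odd m) => /= ? ?; [rewrite metric_sym|]; exact: AO.
  by have := metric_triangle y z y'; rewrite (metric_sym y z); lra.
have [qx|qx] := pselect (q = x).
  have [_ [y [Sy [_ [z [Sz _ Wz]]] Wy]]] := Rx 2%N.
  move: Sy Sz; rewrite -qx segxx => yq; rewrite yq segxx => zq.
  by apply: (AOs 0%N z y q) => //; rewrite ?yq ?zq mdistxx divr_gt0.
have [f [fc f0 f1 sP [fi _ so]]] := seg_order hX Xq Xx qx.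
pose D := [set t : R | 0 <= t <= 1 /\ forall m, osc m (f t)].
have D1 : D 1 by split; [rewrite ler01 lexx|rewrite f1].
have Dlb : lbound D 0 by move=> t [/andP[]].
have hD : has_inf D by split; [exists 1|exists 0].
pose s := inf D.
have s01 : 0 <= s <= 1 by rewrite lb_le_inf//=; [apply: ge_inf => //; exists 0|exists 1].
have s01' : `[0, 1]%classic s by rewrite /= in_itv.
have r2 : 0 < r / 2 by rewrite divr_gt0.
have [d d0 hd] := within_continuousRT fc s01' r2.
have [t [t01 Rt] td] : exists2 t, D t & t < s + d by apply: inf_adherent.
have st : s <= t by apply: ge_inf => //; exists 0.
have Xf (u : R) : 0 <= u <= 1 -> X (f u) by move=> u01; apply: (segX hX Xq Xx); apply/sP; exists u.
have ord (u v : R) : 0 <= v <= 1 -> 0 <= u <= 1 -> (seg q (f v) (f u) <-> u <= v).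
  move=> /andP[v0 v1] u01; rewrite -f0; split=> [/(so 0 v u (lexx _) v0 v1 u01)/andP[]//|uv].
  by apply/(so 0 v u (lexx _) v0 v1 u01); rewrite uv andbT; case/andP: u01.
have pt (u : R) y : 0 <= u <= 1 -> seg q (f u) y -> exists2 v : R, 0 <= v <= 1 & f v = y.
  move=> u01 Sy; apply/sP; apply: (seg_subseg hX) Sy => //; [exact: segl|by apply/sP; exists u].
have [m0 hm0] : exists m0, forall u : R, 0 <= u <= 1 -> osc m0 (f u) -> s - d < u.
  have [sd|sd] := ltP (s - d / 2) 0.
    by exists 0%N => u /andP[u0 _] _; lra.
  have sd01 : 0 <= s - d / 2 <= 1 by case/andP: s01 => ? ?; apply/andP; split; lra.
  have : ~ D (s - d / 2).
    by move=> Dsd; have : s <= s - d / 2 by [apply: ge_inf => //; exists 0]; lra.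
  move=> nD; have /existsNP[m0 nm0] : ~ forall m, osc m (f (s - d / 2)) by move=> h; apply: nD.
  exists m0 => u u01 Ru; rewrite ltNge; apply/negP => us; apply: nm0.
  apply: osc_up Ru; first exact: Xf.
  by apply/ord => //; lra.
have := Rt m0.+2; move=> [_ [y [Sy Ry Wy]]]; case: Ry => Xy [z [Sz Rz Wz]].
have [v v01 vE] := pt _ _ t01 Sy; rewrite -{}vE in Sy Xy Sz Wy.
have [w w01 wE] := pt _ _ v01 Sz; rewrite -{}wE in Sz Rz Wz.
have vt := (ord _ _ t01 v01).1 Sy; have wv := (ord _ _ v01 w01).1 Sz.
have sw := hm0 _ w01 Rz.
apply: (AOs _ _ _ (f s) Wz Wy); apply: hd; rewrite /= ?in_itv//= ltr_norml; lra.
Qed.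

End Oscillation.

(* Baire's theorem, except that S need not be closed: the point may leave S.   *)
Lemma dense_open_inter (Q : nat -> set T) S : S `<=` X -> S !=set0 ->
  (forall m x, Q m x -> exists2 e : R, 0 < e & forall y, X y -> mdist x y < e -> Q m y) ->
  (forall w (e : R) m, S w -> 0 < e -> exists w', [/\ S w', mdist w w' < e & Q m w']) ->
  exists2 x, X x & forall m, Q m x.
Proof.
move=> SX [w0 Sw0] Qo dS.
(* One Baire step: a smaller closed ball, centred in [S], on which [Q] of the given index holds
   within [X]. If the centre is not in [S] or the radius not positive, the pair is returned
   unchanged. *)
have /choice[st hst] (p : nat * (T * R)) : exists p' : T * R, S p.2.1 -> 0 < p.2.2 ->
   [/\ S p'.1, 0 < p'.2, forall z, mdist p'.1 z <= p'.2 -> mdist p.2.1 z <= p.2.2 &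
       forall z, X z -> mdist p'.1 z <= p'.2 -> Q p.1 z].
  case: p => m [w e] /=; have [Sw|nS] := pselect (S w); last by exists (w, e).
  have [e0|e0] := ltP 0 e; last by exists (w, e).
  have e2 : 0 < e / 2 by rewrite divr_gt0.
  have [w' [Sw' ww' Qw']] := dS w _ m Sw e2; have [d d0 hd] := Qo _ _ Qw'.
  have r0 : 0 < Num.min (e / 2) (d / 2) by rewrite lt_min e2 divr_gt0.
  exists (w', Num.min (e / 2) (d / 2)) => _ _; split=> //= z.
    rewrite le_min => /andP[h _]; have := metric_triangle w w' z; lra.
  by move=> Xz; rewrite le_min => /andP[_ h]; apply: hd => //; lra.
pose p := fix p n := if n is n'.+1 then st (n', p n') else (w0, 1 : R).
have hp n : S (p n).1 /\ 0 < (p n).2.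
  by elim: n => [//|n [h1 h2]] /=; have [] := hst (n, p n) h1 h2.
have nest n k z : mdist (p (n + k)%N).1 z <= (p (n + k)%N).2 -> mdist (p n).1 z <= (p n).2.
  elim: k => [|k IH]; first by rewrite addn0.
  have [h1 h2] := hp (n + k)%N.
  by rewrite addnS /= => h; apply: IH; have [_ _ /(_ z)+ _] := hst ((n + k)%N, p (n + k)%N) h1 h2; apply.
have [U UU Uoo] := nonprincipal_ultrafilter.
have [x Xx hx] : exists2 x, X x & ucvg U (fun n => (p n).1) x.
  by apply: (ucvg_exists cX) => n; apply: SX; case: (hp n).
exists x => // m; have [h1 h2] := hp m.
have [_ _ _ /(_ x Xx)+] := hst (m, p m) h1 h2; apply.
rewrite leNgt; apply/negP => h; move: (h); rewrite -subr_gt0 => h'.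
have [n [/= nx mn]] := U_inh (filterI (hx _ h') (U_ge Uoo m.+1)).
have := @nest m.+1 (n - m.+1)%N (p n).1; rewrite subnKC// mdistxx.
have [_ /ltW pn] := hp n => /(_ pn) /=; have := metric_triangle (p m.+1).1 (p n).1 x.
by move: h' nx => /=; lra.
Qed.

End Dendroid.

(** * Monotone sequences, suprema of chains and first entrances *)

Lemma closed_cball {R : realType} {T : metricType R} (x : T) (r : R) : closed [set z | mdist z x <= r].
Proof.
apply: closedmP => y h /=; apply/ler_addgt0Pr => e e0; have [z /= zx yz] := h e e0.
by have := metric_triangle y z x; lra.
Qed.

Section Dendroid.
Context {R : realType} {T : metricType R} (X : set T) (hX : dendroid X).
Implicit Types (a b c d x y z q v w : T) (A O B K F G S : set T).

Notation seg := (arc_of X).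

Let cX : compact X. Proof. by case: hX => [[]]. Qed.

Lemma closure_subcontinuum S : S `<=` X -> S !=set0 -> connected S -> subcontinuum X (closure S).
Proof.
move=> SX [x Sx] Sc; have cS : closure S `<=` X.
  have := compact_closed_m cX; rewrite closure_id => ->; exact: closureS.
split=> //; first by exists x; exact: subset_closure.
- by apply: subclosed_compact cX cS; exact: closed_closure.
- exact: connected_closure.
Qed.

Lemma seg_between q a b c : X q -> X b -> seg q b a -> seg a b c -> seg q c a.
Proof.
move=> Xq Xb Sa Sc; have Xa := segX hX Xq Xb Sa; have Xc := segX hX Xa Xb Sc.
by rewrite segC//; apply: (seg_mid hX Xb Xq); rewrite segC// segC.
Qed.

Lemma seg_above q a b c : X q -> X b -> seg q b a -> seg a b c -> seg q b c.
Proof. by move=> Xq Xb Sa; apply: seg_subseg => //; exact: segr. Qed.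

Lemma seg_trans q a b c : X q -> X c -> seg q c b -> seg q b a -> seg q c a.
Proof. by move=> Xq Xc Sb; apply: seg_subseg => //; exact: segl. Qed.

Lemma seg_seq q (c : nat -> T) : X q -> (forall i, X (c i)) ->
  (forall i, seg q (c i.+1) (c i)) -> forall i j, (i <= j)%N -> seg q (c j) (c i).
Proof.
move=> Xq Xc hc i j /subnK <-; elim: (j - i)%N => [|k IH]; first exact: segr.
by rewrite addSn; apply: seg_trans (hc _) IH.
Qed.

(* Otherwise c n lies on the closure of every tail of the ray through the c i, *)
(* and so does some later c n'.  The arcs from b then oscillate more and more  *)
(* between neighbourhoods of c n and c n'.                                     *)
Lemma monotone_seq_cluster b (c : nat -> T) v : X b -> X v -> (forall i, X (c i)) ->
  (forall i, seg b (c i.+1) (c i)) ->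
  (forall (e : R) N, 0 < e -> exists2 n, (N <= n)%N & mdist (c n) v < e) ->
  forall n, seg b v (c n).
Proof.
move=> Xb Xv Xc hc clv n0; apply: contrapT => n0v.
have mono := seg_seq Xb Xc hc.
have mid i j k : (i <= j)%N -> (j <= k)%N -> seg (c i) (c k) (c j).
  by move=> ij jk; apply: (seg_mid hX Xb (Xc k)); exact: mono.
pose Tl i := [set x | exists2 k, (i <= k)%N & seg (c i) (c k) x].
have Tlc i : Tl i (c i) by exists i => //; exact: segl.
have TlX i : Tl i `<=` X by move=> x [k _]; exact: segX.
have sTl i : subcontinuum X (closure (Tl i)).
  apply: closure_subcontinuum => //; first by exists (c i).
  have -> : Tl i = \bigcup_(k in [set k | (i <= k)%N]) seg (c i) (c k).
    by apply/seteqP; split=> x [k ? ?]; exists k.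
  apply: bigcup_connected; last by move=> k _; exact: seg_connected.
  by exists (c i) => k _; exact: segl.
have Tlv i : closure (Tl i) v.
  apply/closureP => e e0; have [n ni nv] := clv e i e0.
  by exists (c n); [exists n => //; exact: segr|rewrite metric_sym].
have segTl i : seg v (c i) `<=` closure (Tl i).
  by apply: seg_sub => //; apply: subset_closure; exact: Tlc.
have up n i w : (n <= i)%N -> seg b (c i) w -> ~ seg b v w -> closure (Tl i) w.
  by move=> ni Sw nw; have [//|] := seg_tri hX Xb (Xc i) Xv Sw; exact: segTl.
have [n1 n01 n1E] : exists2 n1, (n0 <= n1)%N & c n1 <> c n0.
  apply: contrapT => nh; apply: n0v.
  suff -> : c n0 = v by exact: segr.
  apply: mdist_positivity; apply/eqP; rewrite eq_le mdist_ge0 andbT leNgt; apply/negP => h.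
  have [n n0n] := clv _ n0 h; suff -> : c n = c n0 by rewrite ltxx.
  by apply: contrapT => nn; apply: nh; exists n.
have n1v : ~ seg b v (c n1) by move=> h; apply: n0v; apply: seg_trans h _ => //; exact: mono.
pose r := mdist (c n1) (c n0) / 3.
have d0 : 0 < mdist (c n1) (c n0) by rewrite mdist_gt0; apply/eqP.
have r0 : 0 < r by rewrite /r; lra.
pose A := ball (c n0) r; pose O := ball (c n1) r.
(* The tail beyond [c j] accumulates at [c n0] and at [c n1], so the arc to some later [c k] meets,
   after [c j], whichever of [A] and [O] comes next. *)
have cof m i : exists2 j, (i <= j)%N & osc X b A O m (c j).
  elim: m i => [|m IH] i; first by exists i => //; exact: Xc.
  have [j + Rj] := IH (maxn i n1); rewrite geq_max => /andP[ij n1j].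
  have [y [k jk Sy] Wy] : exists2 y, Tl j y & (if odd m then O else A) y.
    have h0 : closure (Tl j) (c n0).
      by apply: (up n0) => //; [exact: leq_trans n1j|apply: mono; exact: leq_trans n1j].
    have h1 : closure (Tl j) (c n1) by apply: (up n1) => //; exact: mono.
    case: (odd m); [move/closureP : h1|move/closureP : h0] => /(_ r r0)[y Ty yr];
    by exists y => //; apply/ball_mdist.
  exists k; first exact: leq_trans jk.
  have Sy' : seg b (c k) y by apply: seg_above Sy => //; exact: mono.
  split=> //; exists y; split=> //; apply: (osc_up hX Xb) Rj; first exact: segX Sy'.
  apply: seg_between Sy => //; exact: mono.
have S0 : Tl n1 !=set0 by exists (c n1).
have [] := dense_open_inter hX (TlX n1) S0 (Q := osc X b A O).
- by move=> m x; apply: osc_open => //; exact: ball_open_m.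
(* A point [w] of the ray lies in the closure of every later tail, and the points beyond [c i]
   inherit [osc m] from [c i]. *)
- move=> w e m [j n1j Sw] e0.
  have [i + Ri] := cof m (maxn j n1); rewrite geq_max => /andP[ji n1i].
  have Sbw : seg b (c j) w by apply: seg_above Sw => //; exact: mono.
  have /closureP/(_ e e0)[w' [k ik Sw'] ww'] : closure (Tl i) w.
    apply: (up j) => //; first by apply: seg_trans Sbw => //; exact: mono.
    move=> h; apply: n1v; apply: seg_trans h _ => //; apply: seg_between Sw => //; exact: mono.
  exists w'; split=> //.
    exists k; first exact: leq_trans ik.
    by apply: (seg_subseg hX) Sw' => //; [exact: mid|exact: segr].
  apply: (osc_up hX Xb) Ri; first exact: segX Sw'.
  by apply: seg_between Sw' => //; exact: mono.
move=> x Xx Rx; apply: (not_osc_all hX Xb r0) Xx Rx => a o /ball_mdist na /ball_mdist no.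
have := metric_triangle (c n1) o a; have := metric_triangle (c n1) a (c n0).
have := metric_triangle (c n1) a o; rewrite (metric_sym o a) (metric_sym a (c n0)).
have -> : mdist (c n1) (c n0) = 3 * r by rewrite /r; lra.
by lra.
Qed.

(** [v] is a cluster point of the tails of the chain. A sequence in [A] that climbs from [a] and
    tends to [v] puts [a] on [q, v], by [monotone_seq_cluster]. If some [x] on [q, v] bounded [A],
    the closed arc [q, x] would contain [A] and thus [v]; so [v] is the least bound. *)
Lemma chain_sup q A : X q -> A `<=` X -> A !=set0 ->
  (forall a a', A a -> A a' -> seg q a a' \/ seg q a' a) ->
  exists v, [/\ X v, forall a, A a -> seg q v a &
    forall x, seg q v x -> x <> v -> exists a, [/\ A a, seg q a x & x <> a]].
Proof.
move=> Xq AX [a0 Aa0] ch.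
pose tail a := [set a' | A a' /\ seg q a' a].
pose F : set_system T := [set P | exists2 a, A a & tail a `<=` P].
have tl a : A a -> tail a a by move=> Aa; split=> //; apply: segr => //; exact: AX.
have tailS a a' : A a -> A a' -> seg q a a' -> tail a `<=` tail a'.
  by move=> Aa Aa' S z [Az Sz]; split=> //; apply: seg_trans Sz S => //; exact: AX.
have FF : ProperFilter F.
  apply: Build_ProperFilter_ex.
    by move=> P [a Aa aP]; exists a; apply: aP; exact: tl.
  split.
  - by exists a0.
  - move=> P Q [a Aa aP] [a' Aa' aQ]; have [S|S] := ch a a' Aa Aa'.
      by exists a => // z tz; split; [exact: aP|apply: aQ; exact: tailS tz].
    by exists a' => // z tz; split; [apply: aP; exact: tailS tz|exact: aQ].
  - by move=> P Q PQ [a Aa aP]; exists a => // z /aP /PQ.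
have [v [Xv clv]] : X `&` cluster F !=set0.
  by apply: cX; exists a0 => // z [Az _]; exact: AX.
have near a (e : R) : A a -> 0 < e -> exists a', [/\ A a', seg q a' a & mdist a' v < e].
  move=> Aa e0; have [z [[Az Sz] /ball_mdist zv]] := clv (tail a) _ (ex_intro2 _ _ a Aa (fun _ h => h)) (nbhsx_ballx v e e0).
  by exists z; rewrite metric_sym.
have ub a : A a -> seg q v a.
  move=> Aa; have /choice[g hg] (p : nat * T) : exists a', A p.2 -> [/\ A a', seg q a' p.2 & mdist a' v < p.1.+1%:R^-1].
    have [Ap|nA] := pselect (A p.2); last by exists p.2.
    by have [a' h] := near _ _ Ap (@invS_gt0 R p.1); exists a'.
  pose c := fix c n := if n is n'.+1 then g (n'.+1, c n') else g (0%N, a).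
  have Ac n : A (c n).
    elim: n => [|n IH] /=; first by have [] := hg (0%N, a) Aa.
    by have [] := hg (n.+1, c n) IH.
  have cS n : seg q (c n.+1) (c n) by have [] := hg (n.+1, c n) (Ac n).
  have cv n : mdist (c n) v < n.+1%:R^-1.
    case: n => [|n] /=; first by have [] := hg (0%N, a) Aa.
    by have [] := hg (n.+1, c n) (Ac n).
  have h0 : seg q v (c 0%N).
    apply: monotone_seq_cluster => //; first by move=> i; exact: AX.
    move=> e N e0; have [m me] := invS_lt e0; exists (maxn N m); first exact: leq_maxl.
    apply: lt_trans me; apply: lt_le_trans (cv _) _; apply: invS_le; exact: leq_maxr.
  by apply: seg_trans h0 _ => //; have [] := hg (0%N, a) Aa.
exists v; split=> // x Sx xv; have Xx := segX hX Xq Xv Sx; apply: contrapT => nh; apply: xv.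
suff : seg q x v by move=> ?; apply/esym; exact: (seg_anti hX Xq Xv).
apply: (seg_closed hX Xq Xx); apply/closureP => e e0.
have [a [Aa _ av]] := near a0 e Aa0 e0; exists a; last by rewrite metric_sym.
have [//|S] := seg_lin hX Xq Xv Sx (ub a Aa).
suff -> : x = a by apply: segr => //; exact: AX.
by apply: contrapT => xa; apply: nh; exists a.
Qed.

Section Ultra.
Context (U : set_system nat) {UU : UltraFilter U} (Uoo : \oo `<=` U).

(* s_ n is the first point of [nu n, x n] in a small closed ball around u.  If *)
(* every radius failed, the limits for decreasing radii would form a monotone  *)
(* sequence tending to u along arcs issued from u itself.                      *)
Lemma first_entrance (nu x : nat -> T) (y u : T) (e : R) :
  (forall n, X (nu n)) -> (forall n, X (x n)) -> ucvg U nu y ->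
  ulim U (fun n => seg (nu n) (x n)) u -> u <> y -> 0 < e ->
  exists s_ s, [/\ forall n, seg (nu n) (x n) (s_ n), ucvg U s_ s, mdist s u < e,
    ~ ulim U (fun n => seg (nu n) (s_ n)) u &
    ~ (ulim U (fun n => seg (nu n) (s_ n)) `<=` seg s u)].
Proof.
move=> Xnu Xx nuy Lu uy e0; apply: contrapT => nh.
have Xu : X u by move: Lu; apply: ulim_subset; [exact: compact_closed_m|apply: filterS filterT => n _; exact: segX].
have uy0 : 0 < mdist y u by rewrite mdist_gt0; apply/eqP => h; apply: uy.
have entr (k : R) : 0 < k -> exists s_, forall n, seg (nu n) (x n) (s_ n) /\
    ((exists2 z, seg (nu n) (x n) z & mdist u z < k) ->
     mdist (s_ n) u <= k /\ forall z, seg (nu n) (s_ n) z -> mdist z u <= k -> z = s_ n).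
  move=> k0; suff /choice[s_ hs] : forall n, exists s, seg (nu n) (x n) s /\
    ((exists2 z, seg (nu n) (x n) z & mdist u z < k) ->
     mdist s u <= k /\ forall z, seg (nu n) s z -> mdist z u <= k -> z = s) by exists s_.
  move=> n; have [[z Sz uz]|h] := pselect (exists2 z, seg (nu n) (x n) z & mdist u z < k); last first.
    by exists (x n); split=> //; exact: segr.
  have SF : seg (nu n) (x n) `&` [set w | mdist w u <= k] !=set0.
    by exists z; split=> //=; rewrite metric_sym ltW.
  have [c [Sc kc hc]] := seg_first hX (Xnu n) (Xx n) (@closed_cball _ _ u k) SF.
  by exists c.
pose k i : R := Num.min e (mdist y u) / 2 * i.+1%:R^-1.
have m0 : 0 < Num.min e (mdist y u) / 2 by rewrite divr_gt0// lt_min e0 uy0.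
have k0 i : 0 < k i by rewrite mulr_gt0// invS_gt0.
have km i : k i <= Num.min e (mdist y u) / 2.
  by rewrite /k ler_piMr ?(ltW m0)// invf_le1 ?ltr0n// ler1n.
have mm : Num.min e (mdist y u) / 2 < e /\ Num.min e (mdist y u) / 2 < mdist y u.
  have : Num.min e (mdist y u) <= e /\ Num.min e (mdist y u) <= mdist y u by rewrite !ge_min !lexx orbT.
  by move=> [? ?]; lra.
have ke i : k i < e by apply: le_lt_trans (km i) _; case: mm.
have ky i : k i < mdist y u by apply: le_lt_trans (km i) _; case: mm.
have kS i : k i.+1 <= k i by rewrite /k ler_pM2l//; exact: invS_le.
have /choice[s_ hs] i := entr _ (k0 i).
have Xs i n : X (s_ i n) by have [S _] := hs i n; exact: segX S.
have /choice[c hc] i : exists c, X c /\ ucvg U (s_ i) c.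
  by have [c Xc cc] := ucvg_exists cX (Xs i); exists c.
have Xc i : X (c i) by case: (hc i).
pose D i := ulim U (fun n => seg (nu n) (s_ i n)).
have hU i : U [set n | mdist (s_ i n) u <= k i /\ forall z, seg (nu n) (s_ i n) z -> mdist z u <= k i -> z = s_ i n].
  by apply: filterS (Lu _ (k0 i)) => n; exact: (hs i n).2.
have cD i : D i (c i).
  by apply: (@ulim_ucvg _ _ U _ _ (s_ i)) (hc i).2; apply: filterS filterT => n _; exact: segr.
have yD i : D i y.
  by apply: (@ulim_ucvg _ _ U _ _ nu) nuy; apply: filterS filterT => n _; exact: segl.
have sD i : subcontinuum X (D i) by apply: ulim_subcontinuum => // n; exact: seg_cont.
have cu i : mdist (c i) u <= k i.
  apply: (ucvg_closed (@closed_cball _ _ u (k i)) _ (hc i).2).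
  by apply: filterS (hU i) => n [].
(* Before [s_ i n] the arc avoids the closed ball, so inside the open ball the limit [D i] has no
   point but [c i]. *)
have Dball i w : D i w -> mdist w u < k i -> w = c i.
  move=> Dw wk; have [z Sz zw] : exists2 z, forall n, seg (nu n) (s_ i n) (z n) & ucvg U z w.
    by apply: ulim_pick Dw => // n; exists (nu n); exact: segl.
  have wk0 : 0 < k i - mdist w u by rewrite subr_gt0.
  have zs : U [set n | z n = s_ i n].
    apply: filterS2 (hU i) (zw _ wk0) => n /= [_ h] zn; apply: h => //.
    by have := metric_triangle (z n) w u; lra.
  by apply: (@ucvg_unique _ _ U _ (s_ i)) (hc i).2; apply: ucvg_eq zw.
(* Were [u] in [D i], it would be isolated there, and the connected [D i] would reduce to [u]
   although it contains [y]. *)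
have uD i : ~ D i u.
  move=> Du; have uc : u = c i by apply: Dball => //; rewrite mdistxx.
  have h : [set u] = D i.
    have [_ _ _ Dc] := sD i; apply: Dc.
    - by exists u.
    - exists (ball u (k i)); first exact: ball_open_m.
      apply/seteqP; split=> [_ ->|w [Dw /ball_mdist wu]]; first by split=> //; exact: ballxx.
      by rewrite /= uc; apply: Dball => //; rewrite metric_sym.
    - exists [set u]; first by apply: compact_closed_m; exact: compact_set1.
      by apply/seteqP; split=> [_ ->|w []].
  by have := yD i; rewrite -h => /esym.
have DS i : D i `<=` seg u (c i).
  rewrite segC//; apply: contrapT => h; apply: nh; exists (s_ i), (c i); split=> //.
  - by move=> n; case: (hs i n).
  - by case: (hc i).
  - exact: le_lt_trans (cu i) (ke i).
  - exact: uD.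
have cc i : seg u (c i.+1) (c i).
  apply: DS; apply: (@ulim_ucvg _ _ U _ _ (s_ i)) (hc i).2.
  apply: filterS2 (hU i) (hU i.+1) => n /= [h1 h2] [h3 h4].
  have [S|S] := seg_lin hX (Xnu n) (Xx n) (hs i n).1 (hs i.+1 n).1; last by [].
  by rewrite (h2 _ S) ?(le_trans h3)//; exact: segr.
(* The [c i] increase in the order from [u] and yet tend to [u], which forces [c 0 = u], against
   [uD]. *)
have : seg u u (c 0%N).
  apply: monotone_seq_cluster => // d N d0.
  have [m md] := @invS_lt R (d / (Num.min e (mdist y u) / 2)) (divr_gt0 d0 m0).
  exists (maxn N m); first exact: leq_maxl.
  apply: le_lt_trans (cu _) _.
  have : k m < d by rewrite /k mulrC -ltr_pdivlMr.
  apply: le_lt_trans; rewrite /k ler_pM2l//; apply: invS_le; exact: leq_maxr.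
by rewrite segxx => cE; apply: (uD 0%N); rewrite -cE; exact: cD.
Qed.

End Ultra.
End Dendroid.

(** A recursive choice: each new index has to meet finitely many conditions, set by its position and
    by the earlier indices, and each of these holds on a member of [U]. *)
Lemma ultra_select (U : set_system nat) (Q : nat -> set nat) (E : nat -> nat -> nat -> set nat) :
  UltraFilter U -> (forall i, U (Q i)) -> (forall i k j, U (E i k j)) ->
  exists f : nat -> nat, (forall i, Q i (f i)) /\ forall i j, (i < j)%N -> E i (f i) j (f j).
Proof.
move=> UU hQ hE.
have all_E (s : seq nat) j n : U [set l | forall i, (i < n)%N -> E i (nth 0%N s i) j l].
  elim: n => [|n IH]; first by apply: filterS filterT.
  apply: filterS2 IH (hE n (nth 0%N s n) j) => l /= h1 h2 i.
  by rewrite ltnS leq_eqVlt => /orP[/eqP ->//|]; exact: h1.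
have /choice[g hg] (s : seq nat) : exists l, Q (size s) l /\
    forall i, (i < size s)%N -> E i (nth 0%N s i) (size s) l.
  by have [l [h1 h2]] := U_inh (filterI (hQ (size s)) (all_E s (size s) (size s))); exists l.
pose st := fix st n := if n is n'.+1 then rcons (st n') (g (st n')) else [::].
have sz n : size (st n) = n by elim: n => //= n IH; rewrite size_rcons IH.
have nt i n : (i < n)%N -> nth 0%N (st n) i = g (st i).
  elim: n => // n IH; rewrite ltnS leq_eqVlt /= nth_rcons sz => /orP[/eqP ->|h].
    by rewrite ltnn eqxx.
  by rewrite h IH.
exists (fun n => g (st n)); split=> [i|i j ij]; first by have [+ _] := hg (st i); rewrite sz.
by have [_ /(_ i)] := hg (st j); rewrite sz nt//; exact.
Qed.

(** * Branching forced by the semi-Kelley property *)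

Section Dendroid.
Context {R : realType} {T : metricType R} (X : set T) (hX : dendroid X).
Implicit Types (a c x y z q v w : T) (A O B K F G S : set T).

Notation seg := (arc_of X).

Let cX : compact X. Proof. by case: hX => [[]]. Qed.

Definition hits A B := A `&` B !=set0.

Definition gate G x g := G g /\ forall c, G c -> seg x c g.

Section Ultra.
Context (U : set_system nat) {UU : UltraFilter U} (Uoo : \oo `<=` U).

(** No point outside [G] can be joined to almost all [b m] by arcs avoiding [G]. *)
Definition separates G (b : nat -> T) :=
  forall x, X x -> ~ G x -> U [set m | hits (seg x (b m)) G].

Lemma separatesS G G' b : G `<=` G' -> separates G b -> separates G' b.
Proof.
move=> GG' h x Xx nGx; apply: filterS (h x Xx _) => [m [z [Sz Gz]]|/GG'//].
by exists z; split=> //; exact: GG'.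
Qed.

(* The points q' such that q' is on [q, b n] for almost all n form a chain;    *)
(* adding the arc to its supremum, and at most one further arc, is enough.     *)
Lemma separating_extension G0 (b : nat -> T) : subcontinuum X G0 -> (forall n, X (b n)) ->
  exists G, [/\ subcontinuum X G, G0 `<=` G, tame X U G0 -> tame X U G & separates G b].
Proof.
move=> sG0 Xb; have [G0X [q Gq] _ _] := sG0; have Xq := G0X _ Gq.
pose A := [set x | X x /\ U [set n | seg q (b n) x]].
have Aq : A q by split=> //; apply: filterS filterT => n _; exact: segl.
have [v [Xv hv _]] : exists v, [/\ X v, forall a, A a -> seg q v a &
    forall x, seg q v x -> x <> v -> exists a, [/\ A a, seg q a x & x <> a]].
  apply: chain_sup => //; [by move=> x []|by exists q|move=> a a' [_ ha] [_ ha']].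
  have [n [h1 h2]] := U_inh (filterI ha ha').
  by apply/or_comm; apply: (seg_lin hX Xq (Xb n)).
pose G1 := G0 `|` seg q v.
have cG0 : closed G0 by apply: compact_closed_m; case: sG0.
have ext G x : subcontinuum X G -> G q -> X x -> subcontinuum X (G `|` seg q x) /\
    (tame X U G -> tame X U (G `|` seg q x)).
  move=> sG Gq' Xx; have cG : closed G by apply: compact_closed_m; case: sG.
  split; last by move=> tG; apply: tameU => //; [exact: seg_closed|exact: tame_seg].
  by apply: subcontinuumU => //; [exact: seg_cont|exists q; split=> //; exact: segl].
have [sG1 tG1] := ext G0 v sG0 Gq Xv; rewrite -/G1 in sG1 tG1.
have [sep|nsep] := pselect (separates G1 b).
  by exists G1; split=> // x; left.
have /existsNP[x /not_implyP[Xx /not_implyP[nG1x /U_not xG1]]] := nsep.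
have G1q : G1 q by left.
have [sG2 tG2] := ext G1 x sG1 G1q Xx.
exists (G1 `|` seg q x); split=> //.
- by move=> z Gz; left; left.
- by move=> /tG1 /tG2.
move=> x' Xx' nG2x'; apply: contrapT => /U_not x'G2.
(* For almost all [n] the arc from [x'] to [b n] avoids the gate [g], so [g] lies on [q, b n] and on
   [x, b n]. The former puts [g] on [q, v], hence in [G1], which the arcs from [x] were to avoid. *)
have [g Sg hg] := gate_exists hX (seg_cont hX Xq Xx) Xx'.
have Xg : X g := segX hX Xq Xx Sg.
have nx' n : ~ hits (seg x' (b n)) (G1 `|` seg q x) -> ~ seg x' (b n) g.
  by move=> h Sg'; apply: h; exists g; split=> //; right.
have Ag : A g.
  split=> //; apply: filterS x'G2 => n /= /nx' h.
  have := hg q (segl hX Xq Xx); move/(seg_tri hX Xx' Xq (Xb n)) => [//|].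
  by rewrite segC.
have [n [/= h1 /nx' h2]] := U_inh (filterI xG1 x'G2).
apply: h1; exists g; split; last by right; exact: hv.
have := hg x (segr hX Xq Xx); move/(seg_tri hX Xx' Xx (Xb n)) => [//|].
by rewrite segC.
Qed.

(* The boolean index distinguishes two families of arms [p i k, s_ i k], which *)
(* are used alternately.  The part [nu i k, s_ i k] of an arm leaves a         *)
(* neighbourhood of the arc from s i to s (~~ i), so the connected set         *)
(* provided by the semi-Kelley property cannot follow it back to G.            *)
Lemma semi_kelley_branch G (b p s_ nu : bool -> nat -> T) (s : bool -> T) (V : set nat) (e : R) :
  hereditarily_semi_kelley X -> subcontinuum X G ->
  (forall i k, X (b i k)) -> (forall i, separates G (b i)) ->
  (forall i k, gate G (b i k) (p i k)) ->
  (forall i k, seg (p i k) (b i k) (s_ i k)) ->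
  (forall i k, seg (p i k) (s_ i k) (nu i k)) ->
  (forall i, ucvg U (s_ i) (s i)) ->
  (forall i, ~ ulim U (fun k => seg (nu i k) (s_ i k)) (s (~~ i))) ->
  (forall i, ~ (ulim U (fun k => seg (nu i k) (s_ i k)) `<=` seg (s i) (s (~~ i)))) ->
  U V -> 0 < e ->
  exists i k w, [/\ V k, X w & [/\ mdist w (s (~~ i)) < e, ~ hits (seg (b i k) w) G,
    seg (p i k) w (nu i k) & exists j, ulim U (fun k => seg (p j k) (s_ j k)) w]].
Proof.
move=> kX sG Xb sep gp Ss Snu sc nsD nDs UV e0.
have [GX _ cptG cG] := sG; have clG := compact_closed_m cptG.
have Xp i k : X (p i k) by apply: GX; case: (gp i k).
have Xs_ i k : X (s_ i k) := segX hX (Xp i k) (Xb i k) (Ss i k).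
have Xnu i k : X (nu i k) := segX hX (Xp i k) (Xs_ i k) (Snu i k).
have Xs i : X (s i).
  by apply: (ucvg_closed (compact_closed_m cX) _ (sc i)); apply: filterS filterT => k _; exact: Xs_.
pose K := seg (s false) (s true).
have KE i : seg (s i) (s (~~ i)) = K by case: i => //=; rewrite segC.
have sK : subcontinuum X K by exact: seg_cont.
have clK : closed K by exact: seg_closed.
(* [nsD] and [nDs] at a fixed scale: almost every [nu, s_] stays at distance [d] from the opposite
   end of [K] and has a point outside the [2 * d]-neighbourhood of [K]. *)
have [d [d0 de dD]] : exists d : R, [/\ 0 < d, d <= e & forall i, U [set k |
    (forall z, seg (nu i k) (s_ i k) z -> d <= mdist (s (~~ i)) z) /\
    exists2 g, seg (nu i k) (s_ i k) g & ~ set_neighborhood (2 * d) K g]].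
  have /choice[d hd] i : exists d : R, 0 < d /\ forall d', 0 < d' -> d' <= d -> U [set k |
    (forall z, seg (nu i k) (s_ i k) z -> d' <= mdist (s (~~ i)) z) /\
    exists2 g, seg (nu i k) (s_ i k) g & ~ set_neighborhood (2 * d') K g].
    have /existsNP[d1 /not_implyP[d10 /U_not h1]] := nsD i.
    have /existsNP[h /not_implyP[Dh nKh]] := nDs i; rewrite KE in nKh.
    have [d2 d20 h2] := closed_far clK nKh.
    exists (Num.min d1 (d2 / 3)); rewrite lt_min d10 divr_gt0//; split=> // d' d'0.
    rewrite le_min => /andP[dd1 dd2].
    apply: filterS2 h1 (Dh d' d'0) => k /= k1 [g Sg hg]; split.
      move=> z Sz; apply: le_trans dd1 _; rewrite leNgt; apply/negP => zs; apply: k1.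
      by exists z.
    exists g => // /set_neighborhoodP[y Ky gy]; have := h2 y Ky.
    have := metric_triangle h g y; lra.
  have [hf hf'] := hd false; have [ht ht'] := hd true.
  exists (Num.min e (Num.min (d false) (d true))); rewrite !lt_min e0 hf ht ge_min lexx; split=> //.
  by case; [apply: ht'|apply: hf']; rewrite ?lt_min ?e0 ?hf ?ht ?ge_min ?lexx ?orbT.
pose L i := ulim U (fun k => seg (p i k) (s_ i k)).
pose Q n := [set k | [/\ V k,
    (forall z, seg (nu (odd n) k) (s_ (odd n) k) z -> d <= mdist (s (~~ odd n)) z) /\
    (exists2 g, seg (nu (odd n) k) (s_ (odd n) k) g & ~ set_neighborhood (2 * d) K g),
    mdist (s_ (odd n) k) (s (odd n)) < n.+1%:R^-1 &
    seg (p (odd n) k) (s_ (odd n) k) `<=` set_neighborhood (n.+1%:R^-1) (L (odd n))]].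
(* An arm chosen later has its endpoint [b] separated by [G] from the tip of each earlier arm,
   unless that tip is in [G]. *)
pose E m k n := [set l | G (s_ (odd m) k) \/ hits (seg (s_ (odd m) k) (b (odd n) l)) G].
have UQ n : U (Q n).
  have h : U [set k | seg (p (odd n) k) (s_ (odd n) k) `<=` set_neighborhood (n.+1%:R^-1) (L (odd n))].
    by apply: (ulim_upper cX); [move=> k; exact: segX|exact: invS_gt0].
  have h' := sc (odd n) _ (@invS_gt0 R n).
  have h'' : U (V `&` [set k | mdist (s_ (odd n) k) (s (odd n)) < n.+1%:R^-1]) by exact: filterI.
  by apply: filterS3 h'' h (dD (odd n)) => k [h1 h2] h3 h4.
have UE m k n : U (E m k n).
  have [Gs|nGs] := pselect (G (s_ (odd m) k)); first by apply: filterS filterT => l _; left.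
  by apply: filterS (sep (odd n) _ (Xs_ _ _) nGs) => l h; right.
have [f [fQ fE]] := ultra_select UU UQ UE.
pose y n := s_ (odd n) (f n); pose pp n := p (odd n) (f n); pose bb n := b (odd n) (f n).
have Xy n : X (y n) by exact: Xs_.
have Xpp n : X (pp n) by exact: Xp.
have Xbb n : X (bb n) by exact: Xb.
have ppy n c : G c -> seg (y n) c (pp n).
  move=> Gc; have Xc := GX _ Gc; rewrite segC//.
  apply: (seg_between hX (a := pp n) (b := bb n)) => //.
    by rewrite segC//; case: (gp (odd n) (f n)) => _; apply.
  exact: Ss.
have Gpp n : G (pp n) by case: (gp (odd n) (f n)).
pose Z0 := G `|` \bigcup_n seg (pp n) (y n).
have Z0y n : Z0 (y n) by right; exists n => //; exact: segr.
have Z0X : Z0 `<=` X by move=> z [/GX//|[n _]]; exact: segX.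
have sZ : subcontinuum X (closure Z0).
  apply: closure_subcontinuum => //; first by exists (y 0%N).
  have -> : Z0 = \bigcup_n (G `|` seg (pp n) (y n)).
    apply/seteqP; split=> z.
      by move=> [Gz|[n _ Sz]]; [exists 0%N => //; left|exists n => //; right].
    by move=> [n _ [Gz|Sz]]; [left|right; exists n].
  apply: bigcup_connected; first by exists (pp 0%N) => n _; left.
  move=> n _; apply: connectedU => //; last exact: seg_connected.
  by exists (pp n); split=> //; exact: segl.
have yc i (r : R) : 0 < r -> exists N, forall n, (N <= n)%N -> mdist (y (i + n.*2)%N) (s (odd i)) < r.
  move=> r0; have [N Nr] := invS_lt r0; exists N => n Nn; apply: lt_trans Nr.
  have [_ _ + _] := fQ (i + n.*2)%N; rewrite oddD odd_double addbF => h.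
  rewrite /y oddD odd_double addbF; apply: lt_le_trans h _; apply: invS_le.
  by rewrite -addnn addnA; apply: leq_trans Nn _; exact: leq_addl.
have Zs i : closure Z0 (s i).
  apply/closureP => r r0; have [N hN] := yc i r r0.
  exists (y (i + N.*2)%N); first exact: Z0y.
  by have := hN N (leqnn _); rewrite metric_sym oddb.
have sKZ : subcontinuum (closure Z0) K.
  by have [_ K0 cK kc] := sK; split=> //; exact: seg_sub.
have [n [w [C [Cc CZ CK [Cy Cw wt]]]]] : exists n w (C : set T),
    [/\ connected C, C `<=` closure Z0, C `<=` set_neighborhood d K &
        [/\ C (y n), C w & mdist w (s (~~ odd n)) < d]].
  have cZ : compact (closure Z0) by case: sZ.
  have [||n [C [? ? ? [[Cy [w Cw tw]]|[Cy [w Cw tw]]]]]] := semi_kelley_extend cZ (kX _ sZ) sKZ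
    (segl hX (Xs false) (Xs true)) (segr hX (Xs false) (Xs true)) d0 _ _ (yc false) (yc true).
  - by move=> m; apply: subset_closure; exact: Z0y.
  - by move=> m; apply: subset_closure; exact: Z0y.
  - by exists (false + n.*2)%N, w, C; rewrite oddD odd_double metric_sym.
  - by exists (true + n.*2)%N, w, C; rewrite oddD odd_double metric_sym.
have [Vk [far [g Sg gK]] _ _] := fQ n.
have Xw : X w by case: sZ => /(_ w (CZ _ Cw)).
(* The arc from [y n] to [w] lies in the closure of [C], hence close to [K], and misses the far
   point [g] of the arm. It therefore cannot follow the arm back to [nu] or to [G]. *)
have ncl z : seg (y n) w z -> z <> g.
  have C0 : C !=set0 by exists w.
  have CX : C `<=` X by move=> u /CZ; case: sZ => + _ _ _; exact.
  have sC := closure_subcontinuum hX CX C0 Cc.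
  move=> Sz zg; apply: gK; rewrite -zg; apply: (@closure_neighborhood_sub _ _ d); first lra.
  apply: (closureS CK); apply: (seg_sub hX sC _ _ Sz); exact: subset_closure.
have Sgp : seg (y n) (pp n) g.
  rewrite segC//; apply: (seg_subseg hX) Sg => //; [exact: Snu|exact: segr].
have ywG : ~ hits (seg (y n) w) G.
  move=> [c [Sc Gc]]; apply: (ncl g) => //.
  apply: (seg_trans hX _ _ Sc) => //; apply: (seg_trans hX _ _ (ppy n c Gc)) => //; exact: GX.
have nGw : ~ G w by move=> Gw; apply: ywG; exists w; split=> //; exact: segr.
have nGy : ~ G (y n) by move=> Gy; apply: ywG; exists (y n); split=> //; exact: segl.
have nuw : seg (pp n) w (nu (odd n) (f n)).
  have [//|h] := seg_tri hX (Xpp n) (Xy n) Xw (Snu (odd n) (f n)).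
  exfalso; apply: (ncl g) => //; rewrite segC//.
  by apply: (seg_subseg hX) Sg => //; exact: segr.
have ybG m : ~ G (y m) -> ~ hits (seg (bb m) (y m)) G.
  move=> nGym [c [Sc Gc]]; apply: nGym.
  have h : seg (bb m) (y m) (pp m).
    apply: (seg_trans hX _ _ Sc) => //; case: (gp (odd m) (f m)) => _; exact.
  suff -> : y m = pp m by [].
  by apply: (seg_anti hX (Xbb m) (Xy m) h); rewrite segC//; exact: Ss.
have bwG : ~ hits (seg (bb n) w) G.
  move=> [c [Sc Gc]]; have [S|S] := seg_tri hX (Xbb n) Xw (Xy n) Sc.
    by apply: (ybG n nGy); exists c.
  by apply: ywG; exists c.
exists (odd n), (f n), w; split=> //; split=> //; first exact: lt_le_trans wt de.
(* On its own arm, [w] would lie between [nu] and the tip, too far from the opposite end of [K]. On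
   another arm, the arc from [y m] to [y n] would avoid [G], against the choice of [f]. *)
have narm m : ~ seg (pp m) (y m) w.
  move=> Sw; have [mn|mn] := eqVneq m n.
    move: Sw; rewrite mn => Sw; have Sw' : seg (nu (odd n) (f n)) (y n) w.
      exact: (seg_mid hX (Xpp n) (Xy n)).
    have := far w Sw'; rewrite metric_sym => h; lra.
  have ymw : ~ hits (seg (y m) w) G.
    move=> [c [Sc Gc]]; apply: nGw.
    have h : seg (y m) w (pp m) by apply: (seg_trans hX _ _ Sc) => //; exact: ppy.
    suff -> : w = pp m by [].
    by apply: (seg_anti hX (Xy m) Xw h); rewrite segC.
  have nGym : ~ G (y m) by move=> Gy; apply: ymw; exists (y m); split=> //; exact: segl.
  have ymn : ~ hits (seg (y m) (y n)) G.
    move=> [c [Sc Gc]]; have [S|S] := seg_tri hX (Xy m) (Xy n) Xw Sc.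
      by apply: ymw; exists c.
    by apply: ywG; exists c; rewrite segC.
  have nE i j : ~ G (y i) -> ~ G (y j) -> ~ hits (seg (y i) (y j)) G -> ~ (i < j)%N.
    move=> nGi nGj ijG /fE[//|[c [Sc Gc]]]; have [S|S] := seg_tri hX (Xy i) (Xbb j) (Xy j) Sc.
      by apply: ijG; exists c.
    by apply: (ybG j nGj); exists c; rewrite segC.
  move: mn; rewrite neq_ltn => /orP[]; apply: nE => //.
  by rewrite segC.
(* [w] is in the closure of [Z0] but neither in [G] nor on an arm. Finitely many arms stay at a
   positive distance from [w] and the later ones are close to the sets [L i], so [w] lies in one of
   these. *)
apply: contrapT => nL.
have nLi i : ~ L i w by move=> Li; apply: nL; exists i.
have [rG rG0 hG] := closed_far clG nGw.
have [rf rf0 hf] := closed_far (@ulim_closed _ _ U _ _) (nLi false).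
have [rt rt0 ht] := closed_far (@ulim_closed _ _ U _ _) (nLi true).
pose rL := Num.min rf rt.
have rL2 : 0 < rL / 2 by rewrite divr_gt0// lt_min rf0 rt0.
have hL i z : L i z -> rL <= mdist w z by case: i => Lz; rewrite ge_min; [rewrite ht ?orbT|rewrite hf].
have [N Nr] := invS_lt rL2.
have [ra ra0 ha] : exists2 r : R, 0 < r & forall m z, (m < N)%N -> seg (pp m) (y m) z -> r <= mdist w z.
  elim: N {Nr} => [|N [r r0 IH]]; first by exists 1.
  have [r' r'0 hr'] := closed_far (seg_closed hX (Xpp N) (Xy N)) (narm N).
  exists (Num.min r r'); first by rewrite lt_min r0 r'0.
  move=> m z; rewrite ltnS leq_eqVlt ge_min => /orP[/eqP -> Sz|mN Sz].
    by rewrite hr' ?orbT.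
  by rewrite (IH m).
pose r := Num.min rG (Num.min ra (rL / 2)).
have r0 : 0 < r by rewrite !lt_min rG0 ra0 rL2.
have /closureP/(_ r r0)[z + ] := CZ _ Cw; rewrite !lt_min => + /and3P[z1 z2 z3].
move=> [Gz|[m _ Sz]]; first by have := hG z Gz; lra.
have [mN|Nm] := ltnP m N; first by have := ha m z mN Sz; lra.
have [_ _ _ /(_ z Sz)/set_neighborhoodP[z' Lz' zz']] := fQ m.
have := hL _ _ Lz'; have := metric_triangle w z z'.
have zN := lt_le_trans zz' (le_trans (@invS_le R _ _ Nm) (ltW Nr)); lra.
Qed.

End Ultra.
End Dendroid.

(** * Folds are impossible *)

Section Dendroid.
Context {R : realType} {T : metricType R} (X : set T) (hX : dendroid X).
Implicit Types (a c x y z q v w : T) (A O B K F G S : set T).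

Notation seg := (arc_of X).

Let cX : compact X. Proof. by case: hX => [[]]. Qed.

(** Arcs overlapping in a nondegenerate arc [y, q] concatenate: the gate of [x] on [y, z] lies on
    [x, y], and if it were not [y] the overlap would degenerate. *)
Lemma seg_concat x y z q : X x -> X y -> X z -> X q -> y <> q ->
  seg x q y -> seg y z q -> seg x z y.
Proof.
move=> Xx Xy Xz Xq yq Sy Sq.
have [g Sg hg] := gate_exists hX (seg_cont hX Xy Xz) Xx.
suff <- : g = y by apply: hg; exact: segr.
have Xg := segX hX Xy Xz Sg; have gy := hg y (segl hX Xy Xz).
have [Sgq|Sqg] := seg_lin hX Xy Xz Sq Sg.
  apply: (seg_anti hX Xq Xg); rewrite segC//.
  exact: (seg_mid hX Xx Xq Sy gy).
exfalso; apply: yq; apply: (seg_anti hX Xx Xy) => //.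
by apply: (seg_subseg hX) Sqg => //; exact: segr.
Qed.

Lemma gate_of_near G b p w : subcontinuum X G -> X b -> X w -> gate X G b p ->
  ~ hits (seg b w) G -> gate X G w p.
Proof.
move=> [GX _ _ _] Xb Xw [Gp hp] nG; split=> // c Gc; have Xc := GX _ Gc.
have [S|//] := seg_tri hX Xb Xc Xw (hp c Gc).
by exfalso; apply: nG; exists p.
Qed.

Section Ultra.
Context (U : set_system nat) {UU : UltraFilter U} (Uoo : \oo `<=` U).

(** Supplies the hypotheses of [semi_kelley_branch]. [D] and [E] are disjoint, as their union would
    otherwise contain [u1]. So [u1] and [u2] lie on [s, t]; were [D] inside [s, t], a point of [D]
    off [s, u1] would lie beyond [u1] and force [u1] into [D]. The same holds for [E]. *)
Lemma opposite_continua y z (u1 u2 s t : T) (D E : set T) :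
  subcontinuum X D -> subcontinuum X E -> D y -> D s -> E z -> E t ->
  seg y z u1 -> seg u1 z u2 -> seg y u2 u1 ->
  ~ D u1 -> ~ E u2 -> ~ (D `<=` seg s u1) -> ~ (E `<=` seg t u2) ->
  [/\ ~ D t, ~ E s, ~ (D `<=` seg s t) & ~ (E `<=` seg t s)].
Proof.
move=> sD sE Dy Ds Ez Et S1 S2 S3 nD nE nDs nEs.
have Xs := sub_subcontinuum sD Ds; have Xt := sub_subcontinuum sE Et.
have Xy := sub_subcontinuum sD Dy; have Xz := sub_subcontinuum sE Ez.
have S2' : seg y z u2 by apply: (seg_subseg hX) S2 => //; exact: segr.
have nE1 : ~ E u1 by move=> E1; apply: nE; apply: seg_sub S2.
have nD2 : ~ D u2 by move=> D2; apply: nD; apply: seg_sub S3.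
have DE0 : ~ hits D E.
  move=> DE; have sDE := subcontinuumU sD sE DE.
  by have [] // := seg_sub hX sDE (or_introl Dy) (or_intror Ez) S1.
have sst := seg_cont hX Xs Xt.
have sK : subcontinuum X (D `|` seg s t `|` E).
  apply: subcontinuumU => //; last by exists t; split=> //; right; exact: segr.
  by apply: subcontinuumU => //; exists s; split=> //; exact: segl.
have yzK := seg_sub hX sK (or_introl (or_introl Dy)) (or_intror Ez).
have st1 : seg s t u1 by have [[]|] := yzK _ S1.
have st2 : seg s t u2 by have [[]|] := yzK _ S2'.
split.
- by move=> Dt; apply: DE0; exists t.
- by move=> Es; apply: DE0; exists s.
- move=> Dst; apply: nDs => d Dd; have [//|S] := seg_lin hX Xs Xt st1 (Dst _ Dd).
  by exfalso; apply: nD; apply: seg_sub S.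
- rewrite segC// => Est; apply: nEs => d Ed.
  have := Est _ Ed; rewrite segC// => Std; move: (st2); rewrite segC// => Sts2.
  have [//|S] := seg_lin hX Xt Xs Sts2 Std.
  by exfalso; apply: nE; apply: seg_sub S.
Qed.

Section Fold.
Context (G : set T) (b p : nat -> T) (e b0 : T).
Context (kX : hereditarily_semi_kelley X) (sG : subcontinuum X G) (Xb : forall k, X (b k)).
Context (sep : separates X U G b) (gp : forall k, gate X G (b k) (p k)).
Context (pe : ucvg U p e) (bb0 : ucvg U b b0) (Gb0 : G b0).

Let GX : G `<=` X. Proof. exact: sub_subcontinuum. Qed.
Let Gp k : G (p k). Proof. by case: (gp k). Qed.
Let Xp k : X (p k). Proof. exact: GX. Qed.

(* The two families of arms are here the same one, cut at w_ k: arms are       *)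
(* followed from nu k to w_ k, and from w_ k back towards G.                   *)
Lemma fold_branch (w g y : T) (w_ nu : nat -> T) (V : set nat) (r : R) :
  X w -> ~ G w -> gate X G w g -> (forall k, seg (p k) (b k) (w_ k)) -> ucvg U w_ w ->
  (forall k, seg (p k) (w_ k) (nu k)) -> ucvg U nu y -> G y -> U V -> 0 < r ->
  exists k w', [/\ V k, X w', mdist w' w < r, ~ hits (seg (b k) w') G &
    seg (p k) w' (nu k) /\ ulim U (fun k => seg (p k) (b k)) w'].
Proof.
move=> Xw nGw [Gg hg] Sw ww Snu nuy Gy UV r0.
have Xg := GX Gg; have Xy := GX Gy; have Xb0 := GX Gb0.
have Xw_ k : X (w_ k) := segX hX (Xp k) (Xb k) (Sw k).
have Xnu k : X (nu k) := segX hX (Xp k) (Xw_ k) (Snu k).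
have gw : g <> w by move=> gw; apply: nGw; rewrite -gw.
have r3 : 0 < r / 3 by rewrite divr_gt0.
(* The arms run from near [y] in [G] to near [w], then on to near [b0] in [G], so both halves
   accumulate at every point of [g, w]. Cutting each half where it comes near [u] yields the two
   families. *)
have [u [Su ug uw uwr]] := seg_near hX Xg Xw gw r3.
have Xu := segX hX Xg Xw Su.
have nGu : ~ G u.
  move=> Gu; apply: ug; apply: (seg_anti hX Xw Xu); first exact: hg.
  by rewrite segC.
have segGu' c : G c -> seg c w u.
  move=> Gc; have Xc := GX Gc; apply: (seg_subseg hX) Su => //; last exact: segr.
  by rewrite segC//; exact: hg.
have uy : u <> y by move=> uy; apply: nGu; rewrite uy.
have Lu : ulim U (fun n => seg (nu n) (w_ n)) u by apply: (seg_ulim hX) (segGu' y Gy).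
have Ru : ulim U (fun n => seg (w_ n) (b n)) u.
  by apply: (seg_ulim hX Uoo Xw_ Xb ww bb0); rewrite segC//; exact: segGu'.
have [s_ [s [Ss sc su nD nDs]]] := first_entrance hX Uoo Xnu Xw_ nuy Lu uy r3.
have [t_ [t [St tc tu nE nEs]]] := first_entrance hX Uoo Xw_ Xb ww Ru uw r3.
have Xs_ k : X (s_ k) := segX hX (Xnu k) (Xw_ k) (Ss k).
have Xt_ k : X (t_ k) := segX hX (Xw_ k) (Xb k) (St k).
pose D := ulim U (fun n => seg (nu n) (s_ n)); pose E := ulim U (fun n => seg (w_ n) (t_ n)).
have all_n (P : nat -> Prop) : (forall n, P n) -> U [set n | P n].
  by move=> h; apply: filterS filterT => n _; exact: h.
have [] := @opposite_continua y w u u s t D E.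
- by apply: ulim_subcontinuum => // n; exact: seg_cont.
- by apply: ulim_subcontinuum => // n; exact: seg_cont.
- by apply: (ulim_ucvg _ nuy); apply: all_n => n; exact: segl.
- by apply: (ulim_ucvg _ sc); apply: all_n => n; exact: segr.
- by apply: (ulim_ucvg _ ww); apply: all_n => n; exact: segl.
- by apply: (ulim_ucvg _ tc); apply: all_n => n; exact: segr.
- exact: segGu'.
- exact: segl.
- exact: segr.
- by [].
- by [].
- by [].
- by [].
move=> nDt nEs' nDst nEts.
pose s2 (i : bool) := if i then t_ else s_; pose nu2 (i : bool) := if i then w_ else nu.
have ps k : seg (p k) (w_ k) (s_ k) by apply: (seg_above hX) (Snu k) (Ss k).
have [|||||||i [k [w' [Vk Xw' [w's nG pn [j Lj]]]]]] := @semi_kelley_branch R T X hX U UU G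
    (fun=> b) (fun=> p) s2 nu2 (fun i => if i then t else s) V (r / 3) kX sG (fun=> Xb) (fun=> sep) (fun=> gp).
- move=> [|] k /=; first by apply: (seg_above hX) (Sw k) (St k).
  by apply: (seg_trans hX _ _ (Sw k) (ps k)).
- move=> [|] k /=; first by apply: (seg_between hX) (Sw k) (St k).
  by apply: (seg_between hX) (Snu k) (Ss k).
- by case.
- by case.
- by case.
- exact: UV.
- exact: r3.
exists k, w'; split=> //.
- have := metric_triangle w' (if ~~ i then t else s) w.
  have : mdist (if ~~ i then t else s) u < r / 3 by case: (i).
  have := metric_triangle (if ~~ i then t else s) u w.
  by move: w's; lra.
- split; first by case: (i) pn => //= h; apply: (seg_trans hX _ _ h) => //.
  move: Lj; apply: ulim_sub; apply: all_n => n; apply: (seg_subseg hX) => //; first exact: segl.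
  case: (j) => /=; last exact: (seg_trans hX _ _ (Sw n) (ps n)).
  exact: (seg_above hX _ _ (Sw n) (St n)).
Qed.

(** [S] consists of the limit points of arms that lie in [A], off [G], with gate in [O]. By [step],
    points of [S] whose arc from [q] has two more marks accumulate at any point of [S]; every order
    of oscillation is thus dense in [S], and [dense_open_inter] contradicts [not_osc_all]. *)
Lemma no_fold (A O : set T) (r : R) w0 g0 : open A -> open O -> 0 < r ->
  (forall a o, A a -> O o -> r <= mdist a o) -> O e -> A w0 ->
  ulim U (fun k => seg (p k) (b k)) w0 -> ~ G w0 -> gate X G w0 g0 -> O g0 -> False.
Proof.
move=> oA oO r0 AO Oe Aw0 Cw0 nGw0 gw0 Og0.
pose C := ulim U (fun k => seg (p k) (b k)).
have sC : subcontinuum X C by apply: ulim_subcontinuum => // k; exact: seg_cont.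
pose S := [set w | [/\ C w, A w, ~ G w & exists g, gate X G w g /\ O g]].
have SX : S `<=` X by move=> w [Cw _ _ _]; exact: sub_subcontinuum Cw.
have [_ [q Gq] _ _] := sG; have Xq := GX Gq.
pose Q := osc X q A O.
have opn (B : set T) w : open B -> B w -> exists2 d : R, 0 < d & forall z, mdist w z < d -> B z.
  move=> oB Bw; have /nbhs_ballP[d /= d0 hd] := open_nbhs_nbhs (conj oB Bw).
  by exists d => // z wz; apply: hd; apply/ball_mdist.
have UO : U [set k | O (p k)].
  have [d d0 hd] := opn _ _ oO Oe; apply: filterS (pe d0) => k /=; rewrite metric_sym; exact: hd.
have Ge : G e.
  apply: (ucvg_closed _ _ pe); first by apply: compact_closed_m; case: sG.
  by apply: filterS filterT => k _; exact: Gp.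
have inS k w w' d : O (p k) -> X w' -> C w' -> (forall z, mdist w z < d -> A z) ->
    mdist w' w < d -> ~ hits (seg (b k) w') G -> S w' /\ gate X G w' (p k).
  move=> Ok Xw' Cw' hd w'w nG; have gw' := gate_of_near sG (Xb k) Xw' (gp k) nG.
  split=> //; split=> //; [by apply: hd; rewrite metric_sym| |by exists (p k)].
  by move=> Gw'; apply: nG; exists w'; split=> //; exact: segr.
have pick w : S w -> exists2 w_, forall k, seg (p k) (b k) (w_ k) & ucvg U w_ w.
  by move=> [Cw _ _ _]; apply: ulim_pick Cw => // k; exists (p k); exact: segl.
have step m w d : ~~ odd m -> S w -> Q m w -> 0 < d -> exists w', [/\ S w', mdist w w' < d & Q m.+2 w'].
  move=> em Sw Qw d0.
  have [_ Aw nGw [g [gw Og]]] := Sw; have Xw := SX _ Sw.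
  have [d1 d10 hd1] := opn _ _ oA Aw.
  have [d2 d20 hd2] := osc_open hX Xq oA oO Qw.
  pose d3 := Num.min d (Num.min d1 d2).
  have d30 : 0 < d3 by rewrite !lt_min d0 d10 d20.
  have [w_ Sw_ ww] := pick w Sw.
  have h : U ([set k | O (p k)] `&` [set k | hits (seg w (b k)) G]) by apply: filterI => //; exact: sep.
  have d32 : 0 < d3 / 2 by rewrite divr_gt0.
  have [k [w' [[Ok mG] Xw' w'w nG [_ Cw']]]] :=
    fold_branch Xw nGw gw Sw_ ww (fun k => segl hX (Xp k) (segX hX (Xp k) (Xb k) (Sw_ k))) pe Ge h d32.
  have w'd : mdist w' w < d3 by lra.
  have [dd1 dd2] : mdist w' w < d1 /\ mdist w' w < d2.
    by move: w'd; rewrite !lt_min => /and3P[].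
  have [Sw' gw'] := inS k w w' d1 Ok Xw' Cw' hd1 dd1 nG.
  have Qw' : Q m w' by apply: hd2 => //; rewrite metric_sym.
  have ww'G : hits (seg w w') G.
    case: mG => c [Sc Gc]; have [Sc'|Sc'] := seg_tri hX Xw (Xb k) Xw' Sc; first by exists c.
    by exfalso; apply: nG; exists c; rewrite segC.
  have [w'_ Sw'_ ww'] := pick w' Sw'.
  (* [w] and [w'] are limits of points of the same arms, met in a fixed order for almost all [l].
     Let [w1] be the one met first. As [w1, w2] meets [G], the arm passes near the gate [g2] of
     [w2], in [O], between the two. *)
  suff main w1 w2 (w1_ w2_ : nat -> T) g2 : S w1 -> S w2 -> Q m w1 -> gate X G w2 g2 -> O g2 ->
      (forall k, seg (p k) (b k) (w1_ k)) -> (forall k, seg (p k) (b k) (w2_ k)) ->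
      ucvg U w1_ w1 -> ucvg U w2_ w2 -> hits (seg w1 w2) G -> mdist w2 w < d3 / 2 ->
      U [set k | seg (p k) (w2_ k) (w1_ k)] -> exists w', [/\ S w', mdist w w' < d & Q m.+2 w'].
    have : U [set k | seg (p k) (w_ k) (w'_ k) \/ seg (p k) (w'_ k) (w_ k)].
      by apply: filterS filterT => l _; apply: (seg_lin hX (Xp l) (Xb l)).
    case/U_or => hU.
      apply: (main w' w w'_ w_ g) => //; last by rewrite mdistxx.
      by rewrite segC//; exact: SX.
    by apply: (main w w' w_ w'_ (p k)).
  move=> S1 S2 Q1 g2w2 Og2 Sw1 Sw2 c1 c2 [c [Sc Gc]] w2w hU.
  have [_ Aw1 _ _] := S1; have [_ Aw2 nGw2 _] := S2.
  have [Xw1 Xw2] := (SX _ S1, SX _ S2).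
  have Xw1_ l : X (w1_ l) := segX hX (Xp l) (Xb l) (Sw1 l).
  have Xw2_ l : X (w2_ l) := segX hX (Xp l) (Xb l) (Sw2 l).
  (* The default [p l], taken where the order fails, makes [Sv] true for every [l]. *)
  pose v_ l := if `[< seg (p l) (w2_ l) (w1_ l) >] then w1_ l else p l.
  have v_E : U [set l | w1_ l = v_ l] by apply: filterS hU => l /= ?; rewrite /v_ asboolT.
  have Sv l : seg (p l) (w2_ l) (v_ l) by rewrite /v_; case: asboolP => // _; exact: segl.
  have Xv l : X (v_ l) := segX hX (Xp l) (Xw2_ l) (Sv l).
  have vc : ucvg U v_ w1 by exact: ucvg_eq c1.
  have Sg2 : seg w1 w2 g2.
    have Xc := GX Gc; rewrite segC//; case: g2w2 => _ /(_ c Gc).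
    by apply: (seg_subseg hX) => //; [exact: segl|rewrite segC].
  have [nu Snu nuc] : exists2 nu, forall l, seg (v_ l) (w2_ l) (nu l) & ucvg U nu g2.
    have Lg2 : ulim U (fun l => seg (v_ l) (w2_ l)) g2 by exact: (seg_ulim hX Uoo Xv Xw2_ vc c2).
    by apply: ulim_pick Lg2 => // l; exists (v_ l); exact: segl.
  have Xnu l : X (nu l) := segX hX (Xv l) (Xw2_ l) (Snu l).
  have Snu' l : seg (p l) (w2_ l) (nu l) by apply: (seg_above hX) (Snu l).
  have Svnu l : seg (p l) (nu l) (v_ l) by apply: (seg_between hX) (Snu l).
  have [da da0 hda] := opn _ _ oA Aw1; have [dQ dQ0 hdQ] := osc_open hX Xq oA oO Q1.
  have [dO dO0 hdO] := opn _ _ oO Og2.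
  have hV : U ([set l | O (p l)] `&` [set l | [/\ mdist (v_ l) w1 < da, mdist (v_ l) w1 < dQ & mdist (nu l) g2 < dO]]).
    apply: filterI => //; apply: filterS3 (vc _ da0) (vc _ dQ0) (nuc _ dO0) => l /= ? ? ?; by split.
  have [Gg2 _] := g2w2.
  (* The arc from [q] to [x] passes [p l], then [v_ l] near [w1], then [nu l] near [g2]: a mark in
     [A] and a mark in [O] are added to those of [w1]. *)
  have [l [x [[Ol [va vQ nuO]] Xx xw nGx [Sx Cx]]]] :=
    fold_branch Xw2 nGw2 g2w2 Sw2 c2 Snu' nuc Gg2 hV d32.
  have xw' : mdist x w < d3 by have := metric_triangle x w2 w; lra.
  move: (xw'); rewrite !lt_min => /and3P[xd xd1 _].
  have [Sx' [Gpl gx]] := inS l w x d1 Ol Xx Cx hd1 xd1 nGx.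
  exists x; split=> //; first by rewrite metric_sym.
  have qxp : seg q x (p l) by rewrite segC//; exact: gx.
  have qxn : seg q x (nu l) by apply: (seg_above hX) qxp Sx.
  have qxv : seg q x (v_ l).
    apply: (seg_above hX _ _ qxp) => //; exact: (seg_trans hX _ _ Sx (Svnu l)).
  have qnv : seg q (nu l) (v_ l).
    have qnp : seg q (nu l) (p l) by apply: (seg_between hX) Sx.
    by apply: (seg_above hX) qnp (Svnu l).
  split=> //; exists (nu l); split=> //; last by rewrite /= em; apply: hdO; rewrite metric_sym.
  split=> //; exists (v_ l); split=> //; first by apply: hdQ => //; rewrite metric_sym.
  by rewrite (negbTE em); apply: hda; rewrite metric_sym.
have dens m w d : S w -> 0 < d -> exists w', [/\ S w', mdist w w' < d & Q m.*2 w'].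
  move=> Sw; elim: m d => [|m IH] d d0.
    by exists w; split=> //; [rewrite mdistxx|exact: SX].
  have d2 : 0 < d / 2 by rewrite divr_gt0.
  have [w1 [S1 ww1 Q1]] := IH _ d2.
  have [w2 [S2 w12 Q2]] := step m.*2 w1 _ (negbT (odd_double m)) S1 Q1 d2.
  by exists w2; split=> //; have := metric_triangle w w1 w2; lra.
have S0 : S !=set0 by exists w0; split=> //; exists g0.
have [] := dense_open_inter hX SX S0 (Q := Q).
- by move=> m x; exact: osc_open.
- move=> w d m Sw d0; have [w' [? ? Qw']] := dens m w d Sw d0.
  by exists w'; split=> //; apply: (osc_decr hX Xq) Qw'; rewrite -addnn leq_addr.
by move=> x Xx; apply: (not_osc_all hX Xq r0) Xx.
Qed.

End Fold.
End Ultra.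
End Dendroid.

(** * Bad pairs and smoothness *)

Section Dendroid.
Context {R : realType} {T : metricType R} (X : set T) (hX : dendroid X).
Context (kX : hereditarily_semi_kelley X).
Implicit Types (a c x y z q v w : T) (A O B K F G S : set T).

Notation seg := (arc_of X).

Let cX : compact X. Proof. by case: hX => [[]]. Qed.

Section Ultra.
Context (U : set_system nat) {UU : UltraFilter U} (Uoo : \oo `<=` U).

Definition bad (a b : T) : Prop := [/\ X b, a <> b & exists b_ a_ : nat -> T,
  [/\ forall n, X (b_ n), ucvg U b_ b, forall n, seg b (b_ n) (a_ n) & ucvg U a_ a]].

Lemma badX a b : bad a b -> X a.
Proof.
move=> [Xb _ [b_ [a_ [Xb_ _ Sa ac]]]].
apply: (ucvg_closed (compact_closed_m cX) _ ac); apply: filterS filterT => n _.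
exact: segX (Sa n).
Qed.

(** Either almost all [a_ n] lie on the arms, and [y = a]; or they lie on [b, p n], where the part
    from [e] to [p n] shrinks by tameness, so [a] is on [e, b] and [y = e]. *)
Lemma arm_start G (b_ p a_ : nat -> T) (a b : T) : subcontinuum X G -> tame X U G ->
  G a -> G b -> (forall n, X (b_ n)) -> ucvg U b_ b -> (forall n, gate X G (b_ n) (p n)) ->
  (forall n, seg b (b_ n) (a_ n)) -> ucvg U a_ a -> forall e, ucvg U p e ->
  exists (nu : nat -> T) y, [/\ forall n, seg (p n) (b_ n) (nu n), ucvg U nu y, X y & seg y b a].
Proof.
move=> sG tG Ga Gb Xb_ bb gp Sa ac e pe; have GX := sub_subcontinuum sG.
have Gp n : G (p n) by case: (gp n).
have [Xa Xb] := (GX _ Ga, GX _ Gb).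
have Ge : G e.
  apply: (ucvg_closed _ _ pe); first by apply: compact_closed_m; case: sG.
  by apply: filterS filterT => n _; exact: Gp.
have Xe := GX _ Ge; have Xp n := GX _ (Gp n).
have Xa_ n : X (a_ n) := segX hX Xb (Xb_ n) (Sa n).
have : U [set n | seg (p n) (b_ n) (a_ n) \/ seg b (p n) (a_ n)].
  apply: filterS filterT => n _ /=.
  by have [|] := seg_tri hX Xb (Xb_ n) (Xp n) (Sa n); [right|left].
case/U_or => hU.
  pose nu n := if `[< seg (p n) (b_ n) (a_ n) >] then a_ n else p n.
  exists nu, a; split=> //.
  - by move=> n; rewrite /nu; case: asboolP => // _; exact: segl.
  - by apply: ucvg_eq ac; apply: filterS hU => n /= ?; rewrite /nu asboolT.
  - exact: segl.
exists p, e; split=> //; first by move=> n; exact: segl.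
have [<-|ea] := pselect (e = a); first exact: segl.
apply: (seg_closed hX Xe Xb); apply/closureP => d d0.
have ea0 : 0 < Num.min d (mdist e a / 2) by rewrite lt_min d0 divr_gt0// mdist_gt0; apply/eqP.
have te := tG p e Gp pe (mdist e a / 2); have ac' := ac _ ea0.
have e20 : 0 < mdist e a / 2 by rewrite divr_gt0// mdist_gt0; apply/eqP.
have tU := te e20.
have [n [/= h1 [h2 h3]]] : exists n, [set n | seg b (p n) (a_ n)] n /\
    seg e (p n) `<=` ball e (mdist e a / 2) /\ mdist (a_ n) a < Num.min d (mdist e a / 2).
  by apply: U_inh; apply: filterS3 hU tU ac'.
move: h3; rewrite lt_min => /andP[ad ae].
exists (a_ n); last by rewrite metric_sym.
have [|S] := seg_tri hX Xb (Xp n) Xe h1; first by rewrite segC.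
have /ball_mdist ea_ := h2 _ S; have := metric_triangle e (a_ n) a; lra.
Qed.

(** By the hypotheses, [a, b] and [a', b'] both begin along [a, a'], towards each other, and [y],
    [u1], [u2], [y'] occur in this order on an arc. Arms cut near [u1] and [u2] yield a limit point
    [w] of arms near [u1] or [u2] whose gate is near [e] or [e'], which [no_fold] forbids. *)
Lemma bad_conflict (a b a' b' : T) : bad a b -> bad a' b' ->
  ~ seg a b' a' -> ~ seg a' b a -> False.
Proof.
move=> Bab Bab' na' na; have [Xa Xa'] := (badX Bab, badX Bab').
have [Xb ab [b_ [a_ [Xb_ bc Sa ac]]]] := Bab.
have [Xb' ab' [b'_ [a'_ [Xb'_ bc' Sa' ac']]]] := Bab'.
have aa' : a <> a' by move=> aa; apply: na; rewrite -aa; exact: segl.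
have [G [sG [Ga Ga' Gb Gb'] tG sep sep']] : exists G, [/\ subcontinuum X G, [/\ G a, G a', G b & G b'],
    tame X U G, separates X U G b_ & separates X U G b'_].
  pose G0 := seg a a' `|` seg a b `|` seg a' b'.
  have s1 : subcontinuum X (seg a a' `|` seg a b).
    by apply: subcontinuumU; [exact: seg_cont|exact: seg_cont|exists a; split; exact: segl].
  have sG0 : subcontinuum X G0.
    apply: subcontinuumU => //; first exact: seg_cont.
    by exists a'; split; [left; exact: segr|exact: segl].
  have tG0 : tame X U G0.
    apply: tameU; [by apply: compact_closed_m; case: s1|exact: seg_closed| |exact: tame_seg].
    by apply: tameU; [exact: seg_closed|exact: seg_closed|exact: tame_seg|exact: tame_seg].
  have [G1 [sG1 G01 tG1 sep1]] := separating_extension hX sG0 Xb_.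
  have [G2 [sG2 G12 tG2 sep2]] := separating_extension hX sG1 Xb'_.
  exists G2; split=> //; last exact: separatesS G12 sep1; last by apply: tG2; exact: tG1.
  by split; apply/G12/G01; [left; left; exact: segl|left; left; exact: segr|left; right; exact: segr|right; exact: segr].
have GX := sub_subcontinuum sG.
have gex (c_ : nat -> T) : (forall n, X (c_ n)) -> exists p, (forall n, gate X G (c_ n) (p n)) /\ exists2 e, X e & ucvg U p e.
  move=> Xc; have /choice[p gp] n : exists g, gate X G (c_ n) g.
    by have [g Gg hg] := gate_exists hX sG (Xc n); exists g.
  exists p; split=> //; apply: (ucvg_exists cX) => n; apply: GX; by case: (gp n).
have [p [gp [e Xe pe]]] := gex _ Xb_; have [p' [gp' [e' Xe' pe']]] := gex _ Xb'_.
have [nu [y [Snu nuy Xy yba]]] := arm_start sG tG Ga Gb Xb_ bc gp Sa ac pe.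
have [nu' [y' [Snu' nuy' Xy' yba']]] := arm_start sG tG Ga' Gb' Xb'_ bc' gp' Sa' ac' pe'.
have Xp n : X (p n) by apply: GX; case: (gp n).
have Xp' n : X (p' n) by apply: GX; case: (gp' n).
have [c [Sc ca' ca _]] := seg_near hX Xa' Xa (not_eq_sym aa') ltr01.
have Xc := segX hX Xa' Xa Sc.
have Sc' : seg a a' c by rewrite segC.
(* The gate [m] of [z] on [x, d] is not [x], as [x] is off [z, d], and [x, m] is common to [x, d]
   and [x, z]; [u] is taken there close to [x], away from the gate limits. *)
have near_start (x z d : T) : X x -> X z -> X d -> ~ seg z d x -> seg x z c -> c <> x ->
    exists u, [/\ seg x d u, seg x c u, u <> x, u <> c & forall f, f = e \/ f = e' -> u <> f].
  move=> Xx Xz Xd nx Sxc cx; have [m Sm hm] := gate_exists hX (seg_cont hX Xx Xd) Xz.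
  have Xm := segX hX Xx Xd Sm.
  have mx : m <> x by move=> mx; apply: nx; rewrite -mx; apply: hm; exact: segr.
  have Sxm : seg x z m by rewrite segC//; apply: hm; exact: segl.
  have [m1 [Sm1 Sm1c m1x]] : exists m1, [/\ seg x m m1, seg x c m1 & m1 <> x].
    have [S|S] := seg_lin hX Xx Xz Sxm Sxc; last by exists m; split=> //; exact: segr.
    by exists c; split=> //; exact: segr.
  have Xm1 := segX hX Xx Xc Sm1c.
  (* If [f = x], then [u <> x] suffices and the radius 1 is a default. *)
  pose far f := if `[< f = x >] then 1 else mdist f x.
  have far0 f : 0 < far f by rewrite /far; case: asboolP => // fx; rewrite mdist_gt0; apply/eqP.
  have d0 : 0 < Num.min (far e) (far e') by rewrite lt_min !far0.
  have [u [Su um ux ud]] := seg_near hX Xm1 Xx m1x d0.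
  have Sxu : seg x m1 u by rewrite segC.
  exists u; split=> //.
  - apply: (seg_trans hX _ _ Sm) => //; exact: (seg_trans hX _ _ Sm1 Sxu).
  - exact: (seg_trans hX _ _ Sm1c Sxu).
  - move=> uc; apply: um; rewrite uc; apply: (seg_anti hX Xx Xc) => //.
    by rewrite -uc.
  - have ff f : mdist u x < far f -> u <> f.
      by rewrite /far; case: asboolP => [-> //|_ + uf]; rewrite uf ltxx.
    by move: ud; rewrite lt_min => /andP[h h'] f [->|->]; exact: ff.
have [u1 [Sb1 Sc1 ua1 uc1 ue1]] := near_start a a' b Xa Xa' Xb na Sc' ca.
have [u2 [Sb2 Sc2 ua2 uc2 ue2]] := near_start a' a b' Xa' Xa Xb' na' Sc ca'.
have Xu1 := segX hX Xa Xb Sb1; have Xu2 := segX hX Xa' Xb' Sb2.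
have a1 : seg a a' u1 by apply: (seg_trans hX _ _ Sc').
have a2 : seg a' a u2 by apply: (seg_trans hX _ _ Sc).
have c12 : seg u1 u2 c.
  have h1 : seg u1 a' c := seg_mid hX Xa Xa' Sc' Sc1.
  have h2 : seg a' u1 c by rewrite segC.
  by rewrite segC//; apply: (seg_mid hX Xa' Xu1 h2).
have u12 : u1 <> u2 by move=> uu; move: c12; rewrite uu segxx => /esym.
have o1 : seg a u2 u1.
  have h : seg a u2 c by rewrite segC//; apply: (seg_mid hX Xa' Xa Sc).
  exact: (seg_trans hX _ _ h Sc1).
have o2 : seg u1 a' u2.
  have h : seg a' u1 c by rewrite segC//; apply: (seg_mid hX Xa Xa' Sc').
  by rewrite segC//; exact: (seg_trans hX _ _ h Sc2).
have yu1a : seg y u1 a by apply: (seg_between hX) yba Sb1.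
have yu2a' : seg y' u2 a' by apply: (seg_between hX) yba' Sb2.
have y2 : seg y u2 u1.
  apply: (seg_above hX _ _ _ o1) => //.
  by apply: (seg_concat hX _ _ _ _ _ yu1a o1) => //; exact/not_eq_sym.
have y'1 : seg u1 y' u2.
  rewrite segC//; have o2' : seg a' u1 u2 by rewrite segC.
  apply: (seg_above hX _ _ _ o2') => //.
  by apply: (seg_concat hX _ _ _ _ _ yu2a' o2') => //; exact/not_eq_sym.
have yy' : seg y y' u1 by apply: (seg_concat hX _ _ _ _ u12 y2 y'1).
have u1y : u1 <> y by move=> uy; move: yu1a; rewrite uy segxx => ya; apply: ua1; rewrite uy ya.
have u2y : u2 <> y' by move=> uy; move: yu2a'; rewrite uy segxx => ya; apply: ua2; rewrite uy ya.
have Xnu n : X (nu n) := segX hX (Xp n) (Xb_ n) (Snu n).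
have Xnu' n : X (nu' n) := segX hX (Xp' n) (Xb'_ n) (Snu' n).
have L1 : ulim U (fun n => seg (nu n) (b_ n)) u1.
  by apply: (seg_ulim hX Uoo Xnu Xb_ nuy bc); exact: (seg_above hX _ _ yba Sb1).
have L2 : ulim U (fun n => seg (nu' n) (b'_ n)) u2.
  by apply: (seg_ulim hX Uoo Xnu' Xb'_ nuy' bc'); exact: (seg_above hX _ _ yba' Sb2).
(* With the factor 1/4, the [2 * r]-balls around [u1], [u2] and the [r]-balls around [e], [e'] stay
   [r] apart. *)
pose r := Num.min (Num.min (mdist u1 e) (mdist u1 e')) (Num.min (mdist u2 e) (mdist u2 e')) / 4.
have [r0 [r1e r1e' r2e r2e']] : 0 < r /\ [/\ 4 * r <= mdist u1 e, 4 * r <= mdist u1 e',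
    4 * r <= mdist u2 e & 4 * r <= mdist u2 e'].
  split; first by rewrite divr_gt0// !lt_min !mdist_gt0; apply/andP; split; apply/andP; split; apply/eqP;
    (apply: ue1 || apply: ue2); (by left) || (by right).
  by rewrite mulrC divfK// !ge_min !lexx !orbT.
have [s_ [s [Ss sc su nD nDs]]] := first_entrance hX Uoo Xnu Xb_ nuy L1 u1y r0.
have [t_ [t [St tc tu nE nEs]]] := first_entrance hX Uoo Xnu' Xb'_ nuy' L2 u2y r0.
have Xs_ k : X (s_ k) := segX hX (Xnu k) (Xb_ k) (Ss k).
have Xt_ k : X (t_ k) := segX hX (Xnu' k) (Xb'_ k) (St k).
have all_n (P : nat -> Prop) : (forall n, P n) -> U [set n | P n].
  by move=> h; apply: filterS filterT => n _; exact: h.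
have [] := @opposite_continua _ _ X hX y y' u1 u2 s t (ulim U (fun n => seg (nu n) (s_ n)))
  (ulim U (fun n => seg (nu' n) (t_ n))).
- by apply: ulim_subcontinuum => // n; exact: seg_cont.
- by apply: ulim_subcontinuum => // n; exact: seg_cont.
- by apply: (ulim_ucvg _ nuy); apply: all_n => n; exact: segl.
- by apply: (ulim_ucvg _ sc); apply: all_n => n; exact: segr.
- by apply: (ulim_ucvg _ nuy'); apply: all_n => n; exact: segl.
- by apply: (ulim_ucvg _ tc); apply: all_n => n; exact: segr.
- by [].
- by [].
- by [].
- by [].
- by [].
- by [].
- by [].
move=> nDt nEs' nDst nEts.
pose b2 (i : bool) := if i then b'_ else b_; pose p2 (i : bool) := if i then p' else p.
have gp2 : forall i k, gate X G (b2 i k) (p2 i k) by case.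
have Xb2 : forall i k, X (b2 i k) by case.
have Xp2 : forall i k, X (p2 i k) by case.
have sep2 : forall i, separates X U G (b2 i) by case.
pose e2 (i : bool) := if i then e' else e.
pose s2 (i : bool) := if i then t_ else s_.
have Ss2 i k : seg (p2 i k) (b2 i k) (s2 i k).
  by case: i => /=; [exact: (seg_above hX _ _ (Snu' k) (St k))|exact: (seg_above hX _ _ (Snu k) (Ss k))].
have [||||||i [k [w [Vk Xw [ws nG _ [j Lj]]]]]] := @semi_kelley_branch R T X hX U UU G b2 p2
    s2 (fun i => if i then nu' else nu)
    (fun i => if i then t else s) [set n | mdist (p n) e < r /\ mdist (p' n) e' < r] r kX sG Xb2 sep2 gp2 Ss2.
- move=> [|] k /=; first by apply: (seg_between hX) (Snu' k) (St k).
  by apply: (seg_between hX) (Snu k) (Ss k).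
- by case.
- by case.
- by case.
- by apply: filterI; [exact: pe|exact: pe'].
- exact: r0.
have gw := gate_of_near hX sG (Xb2 i k) Xw (gp2 i k) nG.
pose A := ball u1 (2 * r) `|` ball u2 (2 * r); pose O := ball e r `|` ball e' r.
have Oe j' : O (e2 j') by case: j'; [right|left]; exact: ballxx.
have Op : O (p2 i k).
  by case: (Vk) => h h'; case: (i); [right|left]; apply/ball_mdist; rewrite metric_sym.
have Aw : A w.
  case: (i) ws => /= ws; [left|right]; apply/ball_mdist; rewrite metric_sym.
    by have := metric_triangle w s u1; lra.
  by have := metric_triangle w t u2; lra.
have AO x o : A x -> O o -> r <= mdist x o.
  have key v f : 4 * r <= mdist v f -> mdist v x < 2 * r -> mdist f o < r -> r <= mdist x o.
    move=> vf vx fo; have := metric_triangle v x f; have := metric_triangle x o f.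
    by rewrite (metric_sym o f); lra.
  by move=> [/ball_mdist h|/ball_mdist h] [/ball_mdist h'|/ball_mdist h']; apply: key h h'.
have nGw : ~ G w by move=> Gw; apply: nG; exists w; split=> //; exact: segr.
have Cw : ulim U (fun n => seg (p2 j n) (b2 j n)) w.
  move: Lj; apply: ulim_sub; apply: all_n => n; apply: (seg_subseg hX) => //; exact: segl.
have pe2 : ucvg U (p2 j) (e2 j) by case: (j).
have bc2 : ucvg U (b2 j) (if j then b' else b) by case: (j).
have Gb2 : G (if j then b' else b) by case: (j).
apply: (no_fold hX Uoo kX sG (Xb2 j) (sep2 j) (gp2 j) pe2 bc2 Gb2 _ _ r0 AO (Oe j) Aw Cw nGw gw Op).
  by apply: openU; exact: ball_open_m.
by apply: openU; exact: ball_open_m.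
Qed.

End Ultra.

Lemma smooth_dendroid : smooth X.
Proof.
have [U UU Uoo] := nonprincipal_ultrafilter.
have [[_ _ [q [_ [Xq _ _]]]] _ _] := hX.
pose J := [set a | exists2 b, bad U a b & ~ seg q b a].
have JX : J `<=` X by move=> a [b /badX].
have [p Xp hp] : exists2 p, X p & forall a b, bad U a b -> seg p b a.
  have [J0|J0] := pselect (J !=set0); last first.
    by exists q => // a b ab; apply: contrapT => na; apply: J0; exists a, b.
  have [|v [Xv vub vleast]] := chain_sup hX Xq JX J0.
    move=> a a' Ja Ja'; have [Xa Xa'] := (JX _ Ja, JX _ Ja').
    case: Ja Ja' => b Bb nb [b' Bb' nb']; have [Xb _ _] := Bb; have [Xb' _ _] := Bb'.
    apply: contrapT => /not_orP[n1 n2]; apply: (bad_conflict Uoo Bb Bb').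
      move=> /(seg_tri hX Xa Xb' Xq) [h|//]; by apply: n1; rewrite segC.
    by move=> /(seg_tri hX Xa' Xb Xq) [h|//]; apply: n2; rewrite segC.
  exists v => // a b Bab; have Xa : X a by exact: badX Bab.
  have [Xb _ _] := Bab.
  apply: contrapT => na.
  (* If [a] is off [q, b], then [a] is in [J], so on [q, v], hence on [v, b]. Otherwise [a] is
     strictly below [v], and an element of [J] strictly above [a] conflicts with it. *)
  have [qba|nqba] := pselect (seg q b a); last first.
    have [//|h] := seg_tri hX Xq Xv Xb (vub a (ex_intro2 _ _ b Bab nqba)).
    by apply: na; rewrite segC.
  have Sva : seg q v a by have [//|/na] := seg_tri hX Xq Xb Xv qba.
  have av : a <> v by move=> av; apply: na; rewrite av; exact: segl.
  have [a' [Ja' Sa'a aa']] := vleast a Sva av; have Xa' := JX _ Ja'.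
  have [b' Bab' nb'] := Ja'; have [Xb' _ _] := Bab'.
  apply: (bad_conflict Uoo Bab Bab').
    move=> /(seg_tri hX Xa Xb' Xq) [h|//]; apply: aa'.
    by apply: (seg_anti hX Xq Xa) => //; rewrite segC.
  move=> /(seg_tri hX Xa' Xb Xv) [h|//]; apply: aa'.
  have Sva' := vub a' Ja'.
  have h1 : seg v a a' by rewrite segC//; apply: (seg_mid hX Xq Xv Sva').
  by apply: (seg_anti hX Xv Xa) => //; rewrite segC.
exists p => // x_ x Xx_ Xx xx; apply: hausdorff_cvgI => e e0; apply: contrapT => nh.
have /choice[f hf] N : exists n, (N <= n)%N /\ ~ (seg p (x_ n) `<=` set_neighborhood e (seg p x) /\
    seg p x `<=` set_neighborhood e (seg p (x_ n))).
  apply: contrapT => h; apply: nh; exists N => n Nn; apply: contrapT => h'.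
  by apply: h; exists n.
pose y n := x_ (f n).
have Xy n : X (y n) by exact: Xx_.
have yx : ucvg U y x.
  apply: cvg_ucvg => //; apply/cvg_ballP => r r0; move/cvg_ballP : xx => /(_ r r0) [N _ hN].
  by exists N => // n /= Nn; apply: hN => /=; apply: leq_trans Nn _; case: (hf n).
pose L := ulim U (fun n => seg p (y n)).
have pxL : seg p x `<=` L by apply: (seg_ulim hX Uoo _ Xy _ yx) => //; exact: ucvg_cst.
have Lpx : L `<=` seg p x.
  (* [p, y n] lies in the union of [p, x] and [x, y n], so a point of [L] off [p, x] is a limit of
     points of the second arcs, hence bad for [x]; the choice of [p] puts it on [p, x]. *)
  move=> a La; apply: contrapT => na.
  have [a_ Sa ac] : exists2 a_, forall n, seg p (y n) (a_ n) & ucvg U a_ a.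
    by apply: ulim_pick La => // n; exists p; exact: segl.
  have ax : a <> x by move=> ax; apply: na; rewrite ax; exact: segr.
  have hU : U [set n | seg x (y n) (a_ n)].
    have : U [set n | seg p x (a_ n) \/ seg x (y n) (a_ n)].
      by apply: filterS filterT => n _; exact: (seg_tri hX Xp (Xy n) Xx (Sa n)).
    case/U_or => // h; exfalso; apply: na; apply: (ucvg_closed _ h ac); exact: seg_closed.
  apply: na; apply: hp; split=> //.
  exists y, (fun n => if `[< seg x (y n) (a_ n) >] then a_ n else x); split=> //.
    by move=> n; case: asboolP => // _; exact: segl.
  by apply: ucvg_eq ac; apply: filterS hU => n /= ?; rewrite asboolT.
have SX n : seg p (y n) `<=` X by exact: segX.
have h1 : U [set n | seg p (y n) `<=` set_neighborhood e L] by exact: ulim_upper cX SX e0.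
have h2 : U [set n | L `<=` set_neighborhood e (seg p (y n))] by exact: ulim_lower cX SX e0.
have [n [/= k1 k2]] := U_inh (filterI h1 h2); have [_] := hf n; apply; split.
  by move=> z /k1; apply: set_neighborhood_sub.
exact: subset_trans pxL k2.
Qed.

End Dendroid.

Theorem theorem5p7 (R : realType) (T : metricType R) (X : set T)
  (hX : dendroid X) (hK : hereditarily_semi_kelley X) : smooth X.
Proof. exact: smooth_dendroid. Qed.
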